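(* Let $\rho$ be an antisymmetric Fox pairing of degree $n\in\mathbb{Z}$ in a cocommutative graded Hopf algebra $A$. Let $\bullet$ be a balanced biderivation in a commutative ungraded Hopf algebra $B$. Then there is a unique $n$-graded bracket $\{-,-\}$ in the representation algebra $A_B$ such that $$\{x_b,y_c\}=(-1)^{|x''|\,|y'|_n}\,(c''\bullet b^{(2)})\;\rho(x',y')_{s_B(b^{(3)})\,b^{(1)}}\;x''_{b^{(4)}}\;y''_{c'}$$ for all $x,y\in A$ and $b,c\in B$. This $n$-graded bracket is antisymmetric.
   Context: Conventions. $\mathbb{K}$ is a fixed commutative ring; modules, algebras, coalgebras, bialgebras and Hopf algebras are over $\mathbb{K}$, and $\otimes=\otimes_{\mathbb{K}}$. ''Graded'' means $\mathbb{Z}$-graded; ''ungraded'' objects are concentrated in degree $0$. For homogeneous $x$, $|x|$ is its degree and $|x|_n=|x|+n$. The tensor product of graded algebras has multiplication $(x\otimes b)(y\otimes c)=(-1)^{|b||y|}xy\otimes bc$. A graded algebra is commutative if $xy=(-1)^{|x||y|}yx$ for homogeneous $x,y$. In a graded bialgebra $A$ the comultiplication $\Delta_A:A\to A\otimes A$ and counit $\varepsilon_A:A\to\mathbb{K}$ are graded algebra homomorphisms; a graded Hopf algebra has in addition a graded linear antipode $s_A$ with $s_A(x')x''=x's_A(x'')=\varepsilon_A(x)1_A$. Sweedler notation is used: $\Delta(x)=x'\otimes x''=x^{(1)}\otimes x^{(2)}$, with iterated comultiplications $x'\otimes x''\otimes x'''=x^{(1)}\otimes x^{(2)}\otimes x^{(3)}$,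 etc.; the components are homogeneous and, for $x$ homogeneous, their degrees sum to $|x|$. $A$ is cocommutative if $x'\otimes x''=(-1)^{|x'||x''|}x''\otimes x'$ for all $x$ (then $s_A^2=\mathrm{id}$). Representation algebra. For graded bialgebras $A,B$, $A_B$ is the graded algebra generated by symbols $x_b$ ($x\in A$, $b\in B$), with $|x_b|=|x|+|b|$ for homogeneous $x,b$, subject to: bilinearity of $x_b$ in $(x,b)$; $(xy)_b=x_{b'}y_{b''}$; $(1_A)_b=\varepsilon_B(b)1$; $x_{bc}=x'_b x''_c$; $x_{(1_B)}=\varepsilon_A(x)1$; and graded commutativity $x_by_c=(-1)^{|x_b||y_c|}y_cx_b$. Fox pairings. Let $A$ be a graded Hopf algebra with invertible antipode. A Fox pairing of degree $n$ in $A$ is a bilinear map $\rho:A\times A\to A$ with $\rho(A^p,A^q)\subset A^{p+q+n}$, $\rho(x,yz)=\rho(x,y)z+\varepsilon_A(y)\rho(x,z)$ and $\rho(xy,z)=\rho(x,z)\varepsilon_A(y)+x\rho(y,z)$ for all $x,y,z$. Its transpose is $\overline\rho(x,y)=(-1)^{|x|_n|y|_n}s_A^{-1}\rho(s_A(y),s_A(x))$ for homogeneous $x,y$; $\rho$ is antisymmetric if $\overline\rho=-\rho$. Balanced biderivations. Let $B$ be an ungraded Hopf algebra. A bilinear form $\bullet:B\times B\to\mathbb{K}$ is a biderivation if $(bc)\bullet d=\varepsilon_B(b)\,c\bullet d+\varepsilon_B(c)\,b\bullet d$ and $b\bullet(cd)=\varepsilon_B(c)\,b\bullet d+\varepsilon_B(d)\,b\bullet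 c$ for all $b,c,d$. It is balanced if $(b\bullet c'')\,s_B(c')c'''=(c\bullet b'')\,s_B(b''')b'$ for all $b,c\in B$. Brackets. An $n$-graded bracket in a graded algebra $R$ is a bilinear map $\{-,-\}:R\times R\to R$ with $\{R^p,R^q\}\subset R^{p+q+n}$ and, for homogeneous $x,y,z$, $\{x,yz\}=\{x,y\}z+(-1)^{|x|_n|y|}y\{x,z\}$ and $\{xy,z\}=x\{y,z\}+(-1)^{|y||z|_n}\{x,z\}y$. It is antisymmetric if $\{x,y\}=-(-1)^{|x|_n|y|_n}\{y,x\}$ for homogeneous $x,y$. *)

(* Defs.v *)
From HB Require Import structures.
From mathcomp Require Import all_boot all_order all_algebra.
From mathcomp Require Import sesquilinear.
From mathcomp Require Import boolp classical_sets.

Set Implicit Arguments.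
Unset Strict Implicit.
Unset Printing Implicit Defensive.
Import GRing.Theory.
Local Open Scope ring_scope.
Local Open Scope quotient_scope.

Reserved Notation "u \ox v" (at level 40, left associativity).

(* A list of pairs stands for the sum of the corresponding pure tensors; the
   tensor product is the quotient of these formal sums by the congruence
   generated by commutativity of addition and by bilinearity. *)
Section Tensor.
Variables (K : comNzRingType) (U V : lmodType K).

Inductive tensor_eq : seq (U * V) -> seq (U * V) -> Prop :=
| tensor_eq_refl s : tensor_eq s s
| tensor_eq_sym s t : tensor_eq s t -> tensor_eq t s
| tensor_eq_trans s t r : tensor_eq s t -> tensor_eq t r -> tensor_eq s r
| tensor_eq_cat s s' t t' :
    tensor_eq s s' -> tensor_eq t t' -> tensor_eq (s ++ t) (s' ++ t')
| tensor_eq_catC s t : tensor_eq (s ++ t) (t ++ s)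
| tensor_eq_Dl u u' v : tensor_eq [:: (u + u', v)] [:: (u, v); (u', v)]
| tensor_eq_Dr u v v' : tensor_eq [:: (u, v + v')] [:: (u, v); (u, v')]
| tensor_eq_Z a u v : tensor_eq [:: (a *: u, v)] [:: (u, a *: v)]
| tensor_eq_0 v : tensor_eq [:: (0, v)] [::].

Definition tensor_eqb (s t : seq (U * V)) : bool := `[< tensor_eq s t >].

Lemma tensor_eqb_refl : reflexive tensor_eqb.
Proof. by move=> s; apply/asboolP/tensor_eq_refl. Qed.

Lemma tensor_eqb_sym : symmetric tensor_eqb.
Proof. by move=> s t; apply/asboolP/asboolP; apply: tensor_eq_sym. Qed.

Lemma tensor_eqb_trans : transitive tensor_eqb.
Proof.
by move=> t s r /asboolP st /asboolP tr; apply/asboolP/(tensor_eq_trans st tr).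
Qed.

Canonical tensor_equiv :=
  EquivRel tensor_eqb tensor_eqb_refl tensor_eqb_sym tensor_eqb_trans.

Definition tensor := {eq_quot tensor_equiv}.
HB.instance Definition _ := Choice.on tensor.
HB.instance Definition _ : EqQuotient _ tensor_equiv tensor :=
  EqQuotient.on tensor.

Lemma tensorP (s t : seq (U * V)) :
  \pi_tensor s = \pi_tensor t <-> tensor_eq s t.
Proof.
split; first by move/eqmodP/asboolP.
by move=> st; apply/eqmodP/asboolP.
Qed.

Lemma tensor_pi_surj (t : tensor) : exists s, t = \pi_tensor s.
Proof. by exists (repr t); rewrite reprK. Qed.

Definition tensor_add (s t : tensor) : tensor := \pi_tensor (repr s ++ repr t).
Definition tensor_scale (a : K) (s : tensor) : tensor :=
  \pi_tensor [seq (a *: p.1, p.2) | p <- repr s].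

Lemma tensor_pi_add s t : tensor_add (\pi_tensor s) (\pi_tensor t) = \pi_tensor (s ++ t).
Proof.
apply/tensorP; apply: tensor_eq_cat; apply/tensorP; rewrite reprK //.
Qed.

Lemma tensor_eq_Z0 u : tensor_eq [:: (u, 0)] [::].
Proof.
rewrite -[0](scale0r (0 : V)); apply: tensor_eq_trans (tensor_eq_0 0).
by apply: tensor_eq_sym; rewrite -{1}(scale0r u); apply: tensor_eq_Z.
Qed.

Lemma tensor_eq_scale a s t : tensor_eq s t ->
  tensor_eq [seq (a *: p.1, p.2) | p <- s] [seq (a *: p.1, p.2) | p <- t].
Proof.
elim=> {s t} [s|s t _ IH|s t r _ IH1 _ IH2|s s' t t' _ IH1 _ IH2|s t|u u' v
  |u v v'|b u v|v] /=.
- exact: tensor_eq_refl.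
- exact: tensor_eq_sym.
- exact: tensor_eq_trans IH1 IH2.
- by rewrite !map_cat; apply: tensor_eq_cat.
- by rewrite !map_cat; apply: tensor_eq_catC.
- by rewrite scalerDr; apply: tensor_eq_Dl.
- exact: tensor_eq_Dr.
- by rewrite scalerA mulrC -scalerA; apply: tensor_eq_Z.
- by rewrite scaler0; apply: tensor_eq_0.
Qed.

Lemma tensor_pi_scale a s :
  tensor_scale a (\pi_tensor s) = \pi_tensor [seq (a *: p.1, p.2) | p <- s].
Proof. by apply/tensorP/tensor_eq_scale/tensorP; rewrite reprK. Qed.

Lemma tensor_addA : associative tensor_add.
Proof.
move=> x y z; have [r ->] := tensor_pi_surj x; have [s ->] := tensor_pi_surj y.
have [t ->] := tensor_pi_surj z; rewrite (tensor_pi_add s) (tensor_pi_add r).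
by rewrite (tensor_pi_add r) (tensor_pi_add (r ++ s)) catA.
Qed.

Lemma tensor_addC : commutative tensor_add.
Proof.
move=> x y; have [s ->] := tensor_pi_surj x; have [t ->] := tensor_pi_surj y.
rewrite (tensor_pi_add s) (tensor_pi_add t).
by apply/tensorP/tensor_eq_catC.
Qed.

Lemma tensor_add0 : left_id (\pi_tensor [::]) tensor_add.
Proof. by move=> x; have [s ->] := tensor_pi_surj x; rewrite (tensor_pi_add [::]). Qed.

Lemma tensor_eq_cons p s t : tensor_eq s t -> tensor_eq (p :: s) (p :: t).
Proof. by apply: (@tensor_eq_cat [:: p] [:: p]); apply: tensor_eq_refl. Qed.

Lemma tensor_scaleDl s : {morph tensor_scale^~ s : a b / a + b >-> tensor_add a b}.
Proof.
move=> a b; have [t ->] := tensor_pi_surj s; rewrite !(tensor_pi_scale _ t).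
rewrite (tensor_pi_add (map _ t)); apply/tensorP; elim: t {s} => [|[u v] s IH] /=; first exact: tensor_eq_refl.
rewrite scalerDl -cat1s.
apply: tensor_eq_trans (tensor_eq_cat (tensor_eq_Dl _ _ _) IH) _.
apply: (@tensor_eq_cons (a *: u, v)); rewrite -cat1s catA.
rewrite -[(_, _) :: [seq _ | _ <- s]]cat1s catA.
apply: tensor_eq_cat; first exact: tensor_eq_catC.
exact: tensor_eq_refl.
Qed.

Lemma tensor_scale0 s : tensor_scale 0 s = \pi_tensor [::].
Proof.
have [t ->] := tensor_pi_surj s; rewrite (tensor_pi_scale _ t).
apply/tensorP; elim: t {s} => [|[u v] s IH] /=; first exact: tensor_eq_refl.
by rewrite scale0r; apply: (tensor_eq_cat (tensor_eq_0 v) IH).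
Qed.

Lemma tensor_scale1 : left_id 1 tensor_scale.
Proof.
move=> x; have [s ->] := tensor_pi_surj x; rewrite (tensor_pi_scale _ s); congr \pi_tensor.
by rewrite -[RHS]map_id; apply: eq_map => -[u v] /=; rewrite scale1r.
Qed.

Lemma tensor_addN : left_inverse (\pi_tensor [::]) (tensor_scale (-1)) tensor_add.
Proof.
by move=> s; rewrite -{2}[s]tensor_scale1 -tensor_scaleDl addNr tensor_scale0.
Qed.

HB.instance Definition _ := GRing.isZmodule.Build tensor
  tensor_addA tensor_addC tensor_add0 tensor_addN.

Lemma tensor_scaleA a b s :
  tensor_scale a (tensor_scale b s) = tensor_scale (a * b) s.
Proof.
have [t ->] := tensor_pi_surj s; rewrite (tensor_pi_scale _ t).
rewrite !(tensor_pi_scale _ t, tensor_pi_scale a) -map_comp; congr \pi_tensor.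
by apply: eq_map => p /=; rewrite scalerA.
Qed.

Lemma tensor_scaleDr : right_distributive tensor_scale +%R.
Proof.
move=> a x y; have [s ->] := tensor_pi_surj x; have [t ->] := tensor_pi_surj y.
rewrite [_ + _](tensor_pi_add s) (tensor_pi_scale _ (s ++ t)) map_cat.
by rewrite -tensor_pi_add -!tensor_pi_scale.
Qed.

HB.instance Definition _ := GRing.Zmodule_isLmodule.Build K tensor
  tensor_scaleA tensor_scale1 tensor_scaleDr tensor_scaleDl.

Lemma tensor_piD s t : \pi_tensor s + \pi_tensor t = \pi_tensor (s ++ t).
Proof. exact: tensor_pi_add. Qed.

Lemma tensor_piZ a s :
  a *: \pi_tensor s = \pi_tensor [seq (a *: p.1, p.2) | p <- s].
Proof. exact: tensor_pi_scale. Qed.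

Definition tpure (u : U) (v : V) : tensor := \pi_tensor [:: (u, v)].

Lemma tensor_piE s : \pi_tensor s = \sum_(p <- s) tpure p.1 p.2.
Proof.
elim: s => [|[u v] s IH]; first by rewrite big_nil.
by rewrite big_cons /= -IH -cat1s -tensor_pi_add.
Qed.

Lemma tensor_sum_repr (t : tensor) : t = \sum_(p <- repr t) tpure p.1 p.2.
Proof. by rewrite -tensor_piE reprK. Qed.

Lemma tpure_linearl a u u' v :
  tpure (a *: u + u') v = a *: tpure u v + tpure u' v.
Proof.
rewrite /tpure tensor_piZ tensor_piD.
by apply/tensorP/tensor_eq_Dl.
Qed.

Lemma tpure_linearr a u v v' :
  tpure u (a *: v + v') = a *: tpure u v + tpure u v'.
Proof.
rewrite /tpure tensor_piZ tensor_piD.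
apply/tensorP; apply: tensor_eq_trans (tensor_eq_Dr _ _ _) _.
apply: (@tensor_eq_cat [:: _] [:: _]); last exact: tensor_eq_refl.
exact/tensor_eq_sym/tensor_eq_Z.
Qed.

Lemma tpure_is_bilinear : bilinear_for *:%R *:%R tpure.
Proof.
by split=> [v a u u'|u a v v']; [apply: tpure_linearl | apply: tpure_linearr].
Qed.

(* Linear extension of a bilinear map [f]: it sends the sum of the [u_i \ox v_i]
   to the sum of the [f u_i v_i] (lemma [tlift_sum]). *)
Definition tlift (W : nmodType) (f : U -> V -> W) (t : tensor) : W :=
  \sum_(p <- repr t) f p.1 p.2.

End Tensor.

Arguments tpure {K U V} u v.
Arguments tlift {K U V W} f t.
HB.instance Definition _ (K : comNzRingType) (U V : lmodType K) :=
  bilinear_isBilinear.Build K U V (tensor U V) *:%R *:%R (@tpure K U V)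
    (@tpure_is_bilinear K U V).

Notation "u \ox v" := (tpure u v) : ring_scope.

Section TensorLift.
Variables (K : comNzRingType) (U V W : lmodType K) (f : U -> V -> W).
Hypothesis f_bilin : bilinear_for *:%R *:%R f.

Let fPl v a u u' : f (a *: u + u') v = a *: f u v + f u' v.
Proof. exact: (f_bilin.1 v a u u'). Qed.
Let fPr u a v v' : f u (a *: v + v') = a *: f u v + f u v'.
Proof. exact: (f_bilin.2 u a v v'). Qed.
Let fDl u u' v : f (u + u') v = f u v + f u' v.
Proof. by have := fPl v 1 u u'; rewrite !scale1r. Qed.
Let fDr u v v' : f u (v + v') = f u v + f u v'.
Proof. by have := fPr u 1 v v'; rewrite !scale1r. Qed.
Let f0l v : f 0 v = 0.
Proof. by apply: (@addrI _ (f 0 v)); rewrite -fDl !addr0. Qed.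
Let f0r u : f u 0 = 0.
Proof. by apply: (@addrI _ (f u 0)); rewrite -fDr !addr0. Qed.
Let fZl a u v : f (a *: u) v = a *: f u v.
Proof. by have := fPl v a u 0; rewrite f0l !addr0. Qed.
Let fZr a u v : f u (a *: v) = a *: f u v.
Proof. by have := fPr u a v 0; rewrite f0r !addr0. Qed.

Lemma tlift_pi s : tlift f (\pi s) = \sum_(p <- s) f p.1 p.2.
Proof.
have: tensor_eq (repr (\pi_(tensor U V) s)) s by apply/tensorP; rewrite reprK.
rewrite /tlift; move: (repr _) => r; elim=> {s r}
  [s|s t _ ->|s t r _ -> _ ->|s s' t t' _ IH1 _ IH2|s t|u u' v|u v v'|a u v|v] //.
- by rewrite !big_cat IH1 IH2.
- by rewrite !big_cat /= addrC.
- by rewrite !big_cons !big_nil /= fDl !addr0.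
- by rewrite !big_cons !big_nil /= fDr !addr0.
- by rewrite !big_cons !big_nil /= fZl fZr.
- by rewrite !big_cons !big_nil /= f0l !addr0.
Qed.

Lemma tlift_sum (s : seq (U * V)) :
  tlift f (\sum_(p <- s) p.1 \ox p.2) = \sum_(p <- s) f p.1 p.2.
Proof. by rewrite -tensor_piE tlift_pi. Qed.

Lemma tlift_linear : linear (tlift f).
Proof.
move=> a x y; have [s ->] := tensor_pi_surj x; have [t ->] := tensor_pi_surj y.
rewrite tensor_piZ tensor_piD !tlift_pi.
rewrite big_cat big_map scaler_sumr /=; congr (_ + _).
by apply: eq_bigr => p _; rewrite fZl.
Qed.

End TensorLift.

Section TensorMaps.
Variable K : comNzRingType.

Definition tmap (U U' V V' : lmodType K) (f : U -> U') (g : V -> V') :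
  tensor U V -> tensor U' V' := tlift (fun u v => f u \ox g v).

Definition tassoc (U V W : lmodType K) :
  tensor U (tensor V W) -> tensor (tensor U V) W :=
  tlift (fun u => tlift (fun v w => (u \ox v) \ox w)).

End TensorMaps.

HB.mixin Record Algebra_isGraded (K : comNzRingType) A
    of GRing.Algebra K A := {
  gr : int -> set A;
  gr_0 : forall p, gr p 0;
  gr_linear : forall p a x y, gr p x -> gr p y -> gr p (a *: x + y);
  gr_decomp : forall x, exists (s : seq int) (f : int -> A),
    (forall p, gr p (f p)) /\ x = \sum_(p <- s) f p;
  gr_indep : forall (s : seq int) (f : int -> A), uniq s ->
    (forall p, gr p (f p)) -> \sum_(p <- s) f p = 0 ->
    forall p, p \in s -> f p = 0;
  gr_1 : gr 0 1;
  gr_M : forall p q x y, gr p x -> gr q y -> gr (p + q) (x * y)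
}.

#[short(type="gradedAlgType")]
HB.structure Definition GradedAlgebra (K : comNzRingType) :=
  {A of GRing.Algebra K A & Algebra_isGraded K A}.

(* Homogeneous elements; the degree is part of the data, since the zero element
   is homogeneous of every degree. *)
Record homog (K : comNzRingType) (A : gradedAlgType K) := Homog {
  hval : A;
  hdeg : int;
  hvalP : gr hdeg hval
}.
Notation "''|' x |" := (hdeg x) (at level 0, x at level 99, format "''|' x |")
  : ring_scope.

(* Componentwise extension of a family of linear maps, indexed by the degree. *)
Section HomogSum.
Variables (K : comNzRingType) (A : gradedAlgType K).

Lemma sum_by_degree (T : Type) (W : nmodType) (d : T -> int) (G : T -> W) s :
  \sum_(h <- s) G h =
  \sum_(p <- undup [seq d h | h <- s]) \sum_(h <- s | d h == p) G h.
Proof.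
rewrite (exchange_big_dep predT) //=.
have: all (fun h => d h \in undup [seq d h | h <- s]) s.
  rewrite -(all_map d (mem (undup [seq d h | h <- s]))).
  by apply/allP => p /=; rewrite mem_undup.
move: (undup _) (undup_uniq [seq d h | h <- s]) => ps ps_uniq.
elim: s => [|h s IH]; first by rewrite !big_nil.
rewrite /= !big_cons => /andP[hps /IH ->]; congr (_ + _).
rewrite big_mkcond (bigD1_seq (d h)) //= eqxx big1 ?addr0 // => p.
by rewrite eq_sym => /negPf ->.
Qed.

Lemma homog_decomp (x : A) : exists s : seq (homog A), x = \sum_(h <- s) hval h.
Proof.
have [s [f [f_gr ->]]] := gr_decomp x.
by exists [seq Homog (f_gr p) | p <- s]; rewrite big_map.
Qed.

Definition homog_seq (x : A) : seq (homog A) := projT1 (cid (homog_decomp x)).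

Lemma homog_seqE (x : A) : x = \sum_(h <- homog_seq x) hval h.
Proof. by rewrite /homog_seq; case: cid. Qed.

Lemma gr_sum p (I : Type) (r : seq I) (P : pred I) (F : I -> A) :
  (forall i, P i -> gr p (F i)) -> gr p (\sum_(i <- r | P i) F i).
Proof.
move=> F_gr; apply: big_ind => [|x y xp yp|//]; first exact: gr_0.
by rewrite -[x]scale1r; apply: gr_linear.
Qed.

Variables (W : lmodType K) (F : int -> A -> W).

Definition homog_sum (x : A) : W := \sum_(h <- homog_seq x) F (hdeg h) (hval h).

Hypothesis F_lin : forall p, linear (F p).

Let FP p a x y : F p (a *: x + y) = a *: F p x + F p y.
Proof. exact: F_lin. Qed.
Let FD p x y : F p (x + y) = F p x + F p y.
Proof. by have := FP p 1 x y; rewrite !scale1r. Qed.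
Let F0 p : F p 0 = 0.
Proof. by apply: (@addrI _ (F p 0)); rewrite -FD !addr0. Qed.
Let FZ p a x : F p (a *: x) = a *: F p x.
Proof. by have := FP p a x 0; rewrite F0 !addr0. Qed.
Let Fsum p (I : Type) (r : seq I) (P : pred I) (G : I -> A) :
  F p (\sum_(i <- r | P i) G i) = \sum_(i <- r | P i) F p (G i).
Proof. exact: (big_morph (F p) (FD p) (F0 p)). Qed.

Lemma homog_sum_eq0 (s : seq (homog A)) : \sum_(h <- s) hval h = 0 ->
  \sum_(h <- s) F (hdeg h) (hval h) = 0.
Proof.
rewrite (sum_by_degree (@hdeg _ _)) => s0.
rewrite (sum_by_degree (@hdeg _ _)) big1_seq // => p /= ps.
rewrite (eq_bigr (fun h => F p (hval h))) => [|h /eqP -> //].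
rewrite -Fsum -(F0 p); congr (F p _).
apply: (gr_indep _ (fun q => \sum_(h <- s | hdeg h == q) hval h)
  (undup_uniq _) _ s0 _ ps) => q.
by apply: gr_sum => h /eqP <-; apply: hvalP.
Qed.

Lemma homog_sumE (s : seq (homog A)) :
  homog_sum (\sum_(h <- s) hval h) = \sum_(h <- s) F (hdeg h) (hval h).
Proof.
set x := \sum_(h <- s) _; apply/eqP; rewrite -subr_eq0; apply/eqP.
have opp_gr (h : homog A) : gr (hdeg h) (- hval h).
  by rewrite -scaleN1r -[_ *: _]addr0; apply: gr_linear; [apply: hvalP|apply: gr_0].
have := @homog_sum_eq0 (homog_seq x ++ [seq Homog (opp_gr h) | h <- s]).
rewrite !big_cat !big_map /= -homog_seqE sumrN subrr => /(_ erefl) E.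
rewrite /homog_sum -[RHS]E; congr (_ + _); rewrite -sumrN; apply: eq_bigr => h _.
by rewrite -!scaleN1r FZ.
Qed.

Lemma homog_sum_homog p x : gr p x -> homog_sum x = F p x.
Proof.
by move=> xp; have := homog_sumE [:: Homog xp]; rewrite !big_seq1.
Qed.

Lemma homog_sum_linear : linear homog_sum.
Proof.
move=> a x y.
have Z_gr (h : homog A) : gr (hdeg h) (a *: hval h).
  by rewrite -[_ *: _]addr0; apply: gr_linear; [apply: hvalP|apply: gr_0].
have := homog_sumE ([seq Homog (Z_gr h) | h <- homog_seq x] ++ homog_seq y).
rewrite !big_cat !big_map /= -scaler_sumr -!homog_seqE => ->.
by congr (_ + _); rewrite scaler_sumr; apply: eq_bigr => h _; rewrite FZ.
Qed.

End HomogSum.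

Definition ksign (K : comNzRingType) (m : int) : K := (-1) ^+ `|m|%N.
Arguments ksign {K} m.

(* A finite expansion of a tensor into pure tensors with homogeneous factors:
   the indexed form of the Sweedler notation. *)
Definition hexp (K : comNzRingType) (A B : gradedAlgType K)
  (t : tensor A B) (s : seq (homog A * homog B)) : Prop :=
  t = \sum_(p <- s) hval p.1 \ox hval p.2.

Definition tensor_gr (K : comNzRingType) (A B : gradedAlgType K)
  (n : int) (t : tensor A B) : Prop :=
  exists2 s, hexp t s & all (fun p => '|p.1| + '|p.2| == n) s.

Definition graded_commutative (K : comNzRingType) (A : gradedAlgType K) : Prop :=
  forall x y : homog A, hval x * hval y = ksign ('|x| * '|y|) *: (hval y * hval x).

Definition ungraded (K : comNzRingType) (A : gradedAlgType K) : Prop :=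
  forall x : A, gr 0 x.

(* [comulM] is multiplicativity of the comultiplication for the product
   (x \ox b)(y \ox c) = (-1)^(|b||y|) xy \ox bc of A \ox A. *)
HB.mixin Record GradedAlgebra_isBialgebra (K : comNzRingType) A
    of GradedAlgebra K A := {
  comul : {linear A -> tensor A A};
  counit : {lrmorphism A -> K | *%R};
  comul_gr : forall p (x : A), gr p x -> tensor_gr p (comul x);
  counit_gr : forall p (x : A), gr p x -> p != 0 -> counit x = 0;
  comul_coassoc : forall x : A,
    tmap comul id (comul x) = tassoc (tmap id comul (comul x));
  counit_comull : forall x : A, tlift (fun u v => counit u *: v) (comul x) = x;
  counit_comulr : forall x : A, tlift (fun u v => counit v *: u) (comul x) = x;
  comul1 : comul 1 = 1 \ox 1;
  comulM : forall (x y : A) s t, hexp (comul x) s -> hexp (comul y) t ->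
    comul (x * y) = \sum_(p <- s) \sum_(q <- t)
      ksign ('|p.2| * '|q.1|) *: ((hval p.1 * hval q.1) \ox (hval p.2 * hval q.2))
}.

#[short(type="gradedBialgType")]
HB.structure Definition GradedBialgebra (K : comNzRingType) :=
  {A of GradedAlgebra K A & GradedAlgebra_isBialgebra K A}.

HB.mixin Record GradedBialgebra_isHopf (K : comNzRingType) A
    of GradedBialgebra K A := {
  antipode : {linear A -> A};
  antipode_gr : forall p (x : A), gr p x -> gr p (antipode x);
  antipodel : forall x : A,
    tlift (fun u v => antipode u * v) (comul x) = counit x *: 1;
  antipoder : forall x : A,
    tlift (fun u v => u * antipode v) (comul x) = counit x *: 1
}.

#[short(type="gradedHopfType")]
HB.structure Definition GradedHopf (K : comNzRingType) :=
  {A of GradedBialgebra K A & GradedBialgebra_isHopf K A}.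

(* [sweedler3 F x] is the sum of the F x' x'' x''', for F
   multilinear, and similarly for [sweedler2] and [sweedler4]. *)
Section Sweedler.
Variables (K : comNzRingType) (A : gradedBialgType K) (W : nmodType).

Definition sweedler2 (F : A -> A -> W) (x : A) : W := tlift F (comul x).
Definition sweedler3 (F : A -> A -> A -> W) (x : A) : W :=
  sweedler2 (fun x1 => sweedler2 (F x1)) x.
Definition sweedler4 (F : A -> A -> A -> A -> W) (x : A) : W :=
  sweedler2 (fun x1 => sweedler3 (F x1)) x.

End Sweedler.

Definition cocommutative (K : comNzRingType) (A : gradedBialgType K) : Prop :=
  forall (x : A) s, hexp (comul x) s ->
    comul x = \sum_(p <- s) ksign ('|p.1| * '|p.2|) *: (hval p.2 \ox hval p.1).

(* The algebra presented by generators x_b and the stated relations, as the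
   quotient of formal algebra expressions by the smallest congruence containing
   the axioms of K-algebras and the relations on the generators (constructors
   [req_gen_*]).  In the relations involving a
   comultiplication, [s] is any expansion of it into pure tensors. *)
Section Representation.
Variables (K : comNzRingType) (A B : gradedBialgType K).

Inductive rterm : Type :=
| RGen of A & B
| RZero
| ROne
| RAdd of rterm & rterm
| RMul of rterm & rterm
| RScale of K & rterm.

HB.instance Definition _ := gen_eqMixin rterm.
HB.instance Definition _ := gen_choiceMixin rterm.

Definition rsum (s : seq rterm) : rterm := foldr RAdd RZero s.

Inductive req : rterm -> rterm -> Prop :=
| req_refl t : req t t
| req_sym t u : req t u -> req u t
| req_trans t u v : req t u -> req u v -> req t v
| req_add t t' u u' : req t t' -> req u u' -> req (RAdd t u) (RAdd t' u')
| req_mul t t' u u' : req t t' -> req u u' -> req (RMul t u) (RMul t' u')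
| req_scale a t t' : req t t' -> req (RScale a t) (RScale a t')
| req_addA t u v : req (RAdd t (RAdd u v)) (RAdd (RAdd t u) v)
| req_addC t u : req (RAdd t u) (RAdd u t)
| req_add0 t : req (RAdd RZero t) t
| req_addN t : req (RAdd (RScale (-1) t) t) RZero
| req_mulA t u v : req (RMul t (RMul u v)) (RMul (RMul t u) v)
| req_mul1l t : req (RMul ROne t) t
| req_mul1r t : req (RMul t ROne) t
| req_mulDl t u v : req (RMul (RAdd t u) v) (RAdd (RMul t v) (RMul u v))
| req_mulDr t u v : req (RMul t (RAdd u v)) (RAdd (RMul t u) (RMul t v))
| req_scaleA a b t : req (RScale a (RScale b t)) (RScale (a * b) t)
| req_scale1 t : req (RScale 1 t) t
| req_scaleDr a t u : req (RScale a (RAdd t u)) (RAdd (RScale a t) (RScale a u))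
| req_scaleDl a b t : req (RScale (a + b) t) (RAdd (RScale a t) (RScale b t))
| req_scaleAl a t u : req (RScale a (RMul t u)) (RMul (RScale a t) u)
| req_scaleAr a t u : req (RScale a (RMul t u)) (RMul t (RScale a u))
| req_gen_linearl a x y b :
    req (RGen (a *: x + y) b) (RAdd (RScale a (RGen x b)) (RGen y b))
| req_gen_linearr a x b c :
    req (RGen x (a *: b + c)) (RAdd (RScale a (RGen x b)) (RGen x c))
| req_gen_mull x y b (s : seq (B * B)) :
    comul b = \sum_(p <- s) p.1 \ox p.2 ->
    req (RGen (x * y) b) (rsum [seq RMul (RGen x p.1) (RGen y p.2) | p <- s])
| req_gen_1l b : req (RGen 1 b) (RScale (counit b) ROne)
| req_gen_mulr x b c (s : seq (A * A)) :
    comul x = \sum_(p <- s) p.1 \ox p.2 ->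
    req (RGen x (b * c)) (rsum [seq RMul (RGen p.1 b) (RGen p.2 c) | p <- s])
| req_gen_1r x : req (RGen x 1) (RScale (counit x) ROne)
| req_gen_comm (x y : homog A) (b c : homog B) :
    req (RMul (RGen (hval x) (hval b)) (RGen (hval y) (hval c)))
        (RScale (ksign (('|x| + '|b|) * ('|y| + '|c|)))
          (RMul (RGen (hval y) (hval c)) (RGen (hval x) (hval b)))).

Definition reqb (t u : rterm) : bool := `[< req t u >].

Lemma reqb_refl : reflexive reqb.
Proof. by move=> s; apply/asboolP/req_refl. Qed.

Lemma reqb_sym : symmetric reqb.
Proof. by move=> s t; apply/asboolP/asboolP; apply: req_sym. Qed.

Lemma reqb_trans : transitive reqb.
Proof.
by move=> t s r /asboolP st /asboolP tr; apply/asboolP/(req_trans st tr).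
Qed.

Canonical req_equiv := EquivRel reqb reqb_refl reqb_sym reqb_trans.

Definition repalg := {eq_quot req_equiv}.
HB.instance Definition _ := Choice.on repalg.
HB.instance Definition _ : EqQuotient _ req_equiv repalg := EqQuotient.on repalg.

Definition rclass (t : rterm) : repalg := \pi_repalg t.

Lemma rclassP t u : rclass t = rclass u <-> req t u.
Proof.
split; first by move/eqmodP/asboolP.
by move=> tu; apply/eqmodP/asboolP.
Qed.

Lemma rclass_repr u : rclass (repr u) = u.
Proof. exact: reprK. Qed.

Lemma req_repr t : req (repr (rclass t)) t.
Proof. by apply/rclassP; rewrite rclass_repr. Qed.

Lemma rclassW (P : repalg -> Prop) : (forall t, P (rclass t)) -> forall u, P u.
Proof. by move=> Pt u; rewrite -[u]rclass_repr. Qed.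

Definition repalg_add (u v : repalg) := rclass (RAdd (repr u) (repr v)).
Definition repalg_mul (u v : repalg) := rclass (RMul (repr u) (repr v)).
Definition repalg_scale (a : K) (u : repalg) := rclass (RScale a (repr u)).

Lemma repalg_addE t u : repalg_add (rclass t) (rclass u) = rclass (RAdd t u).
Proof. by apply/rclassP/req_add; apply: req_repr. Qed.

Lemma repalg_mulE t u : repalg_mul (rclass t) (rclass u) = rclass (RMul t u).
Proof. by apply/rclassP/req_mul; apply: req_repr. Qed.

Lemma repalg_scaleE a t : repalg_scale a (rclass t) = rclass (RScale a t).
Proof. by apply/rclassP/req_scale/req_repr. Qed.

Lemma repalg_addA : associative repalg_add.
Proof.
move=> x y z; elim/rclassW: x => t; elim/rclassW: y => u; elim/rclassW: z => v.
rewrite (repalg_addE u) (repalg_addE t) (repalg_addE t) (repalg_addE (RAdd t u)).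
exact/rclassP/req_addA.
Qed.

Lemma repalg_addC : commutative repalg_add.
Proof.
move=> x y; elim/rclassW: x => t; elim/rclassW: y => u.
rewrite (repalg_addE t) (repalg_addE u); exact/rclassP/req_addC.
Qed.

Lemma repalg_add0 : left_id (rclass RZero) repalg_add.
Proof.
by move=> x; elim/rclassW: x => t; rewrite (repalg_addE RZero); apply/rclassP/req_add0.
Qed.

Lemma repalg_addN : left_inverse (rclass RZero) (repalg_scale (-1)) repalg_add.
Proof.
move=> x; elim/rclassW: x => t; rewrite (repalg_scaleE _ t).
by rewrite (repalg_addE (RScale _ t)); apply/rclassP/req_addN.
Qed.

HB.instance Definition _ := GRing.isZmodule.Build repalg
  repalg_addA repalg_addC repalg_add0 repalg_addN.

Lemma rclassD t u : rclass (RAdd t u) = rclass t + rclass u.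
Proof. by rewrite -repalg_addE. Qed.

Lemma repalg_mulA : associative repalg_mul.
Proof.
move=> x y z; elim/rclassW: x => t; elim/rclassW: y => u; elim/rclassW: z => v.
rewrite (repalg_mulE u) (repalg_mulE t) (repalg_mulE t) (repalg_mulE (RMul t u)).
exact/rclassP/req_mulA.
Qed.

Lemma repalg_mul1l : left_id (rclass ROne) repalg_mul.
Proof.
by move=> x; elim/rclassW: x => t; rewrite (repalg_mulE ROne); apply/rclassP/req_mul1l.
Qed.

Lemma repalg_mul1r : right_id (rclass ROne) repalg_mul.
Proof.
by move=> x; elim/rclassW: x => t; rewrite (repalg_mulE t); apply/rclassP/req_mul1r.
Qed.

Lemma repalg_mulDl : left_distributive repalg_mul +%R.
Proof.
move=> x y z; elim/rclassW: x => t; elim/rclassW: y => u; elim/rclassW: z => v.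
rewrite -rclassD (repalg_mulE (RAdd t u)) (repalg_mulE t) (repalg_mulE u) -rclassD.
exact/rclassP/req_mulDl.
Qed.

Lemma repalg_mulDr : right_distributive repalg_mul +%R.
Proof.
move=> x y z; elim/rclassW: x => t; elim/rclassW: y => u; elim/rclassW: z => v.
rewrite -rclassD (repalg_mulE t (RAdd u v)) (repalg_mulE t) (repalg_mulE t v).
by rewrite -rclassD; apply/rclassP/req_mulDr.
Qed.

Lemma counit_sum (C : gradedBialgType K) (c : C) (s : seq (C * C)) :
  comul c = \sum_(p <- s) p.1 \ox p.2 ->
  \sum_(p <- s) counit p.1 * counit p.2 = counit c.
Proof.
move=> Ec; rewrite -[c in RHS]counit_comull Ec tlift_sum.
  by rewrite linear_sum; apply: eq_bigr => p _; rewrite linearZ.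
split=> [v a u u'|u a v v'] /=; first by rewrite linearP scalerDl scalerA.
by rewrite scalerDr !scalerA mulrC.
Qed.

Fixpoint rterm_counit (t : rterm) : K :=
  match t with
  | RGen x b => counit x * counit b
  | RZero => 0
  | ROne => 1
  | RAdd t u => rterm_counit t + rterm_counit u
  | RMul t u => rterm_counit t * rterm_counit u
  | RScale a t => a * rterm_counit t
  end.

Lemma rterm_counit_sum s :
  rterm_counit (rsum s) = \sum_(t <- s) rterm_counit t.
Proof. by elim: s => [|t s IH] /=; rewrite ?big_nil // big_cons IH. Qed.

Lemma req_counit t u : req t u -> rterm_counit t = rterm_counit u.
Proof.
elim=> {t u} //=.
- by move=> t u v _ -> _ ->.
- by move=> t t' u u' _ -> _ ->.
- by move=> t t' u u' _ -> _ ->.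
- by move=> a t t' _ ->.
- by move=> t u v; rewrite addrA.
- by move=> t u; rewrite addrC.
- by move=> t; rewrite add0r.
- by move=> t; rewrite mulN1r addNr.
- by move=> t u v; rewrite mulrA.
- by move=> t; rewrite mul1r.
- by move=> t; rewrite mulr1.
- by move=> t u v; rewrite mulrDl.
- by move=> t u v; rewrite mulrDr.
- by move=> a b t; rewrite mulrA.
- by move=> t; rewrite mul1r.
- by move=> a t u; rewrite mulrDr.
- by move=> a b t; rewrite mulrDl.
- by move=> a t u; rewrite mulrA.
- by move=> a t u; rewrite mulrCA.
- by move=> a x y b; rewrite linearP /= mulrDl mulrA.
- by move=> a x b c; rewrite linearP /= mulrDr mulrCA.
- move=> x y b s /counit_sum <-; rewrite rterm_counit_sum big_map rmorphM.
  by rewrite mulr_sumr; apply: eq_bigr => p _ /=; rewrite mulrACA.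
- by move=> b; rewrite rmorph1 mul1r mulr1.
- move=> x b c s /counit_sum <-; rewrite rterm_counit_sum big_map rmorphM.
  by rewrite mulr_suml; apply: eq_bigr => p _ /=; rewrite mulrACA.
- by move=> x; rewrite rmorph1.
- move=> x y b c; have [x0|x0] := eqVneq ('|x|) 0; last first.
    by rewrite (counit_gr _ _ (hvalP x) x0) !(mul0r, mulr0).
  have [b0|b0] := eqVneq ('|b|) 0; last first.
    by rewrite (counit_gr _ _ (hvalP b) b0) !(mul0r, mulr0).
  by rewrite x0 b0 add0r mul0r /ksign expr0 mul1r mulrC.
Qed.

Lemma repalg_oner_neq0 : rclass ROne != 0.
Proof.
by apply/eqP => /rclassP/req_counit /= /eqP; rewrite oner_eq0.
Qed.

HB.instance Definition _ := GRing.Zmodule_isNzRing.Build repalg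
  repalg_mulA repalg_mul1l repalg_mul1r repalg_mulDl repalg_mulDr
  repalg_oner_neq0.

Lemma rclassM t u : rclass (RMul t u) = rclass t * rclass u.
Proof. by rewrite -repalg_mulE. Qed.

Lemma repalg_scaleA a b u :
  repalg_scale a (repalg_scale b u) = repalg_scale (a * b) u.
Proof.
elim/rclassW: u => t; rewrite (repalg_scaleE b t) (repalg_scaleE a).
by rewrite (repalg_scaleE _ t); apply/rclassP/req_scaleA.
Qed.

Lemma repalg_scale1 : left_id 1 repalg_scale.
Proof.
by move=> u; elim/rclassW: u => t; rewrite (repalg_scaleE _ t); apply/rclassP/req_scale1.
Qed.

Lemma repalg_scaleDr : right_distributive repalg_scale +%R.
Proof.
move=> a x y; elim/rclassW: x => t; elim/rclassW: y => u.
rewrite -rclassD (repalg_scaleE a (RAdd t u)) (repalg_scaleE a t).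
by rewrite (repalg_scaleE a u) -rclassD; apply/rclassP/req_scaleDr.
Qed.

Lemma repalg_scaleDl u : {morph repalg_scale^~ u : a b / a + b}.
Proof.
move=> a b; elim/rclassW: u => t; rewrite !(repalg_scaleE _ t) -rclassD.
exact/rclassP/req_scaleDl.
Qed.

HB.instance Definition _ := GRing.Zmodule_isLmodule.Build K repalg
  repalg_scaleA repalg_scale1 repalg_scaleDr repalg_scaleDl.

Lemma rclassZ a t : rclass (RScale a t) = a *: rclass t.
Proof. by rewrite -repalg_scaleE. Qed.

Lemma repalg_scaleAl (a : K) (u v : repalg) : a *: (u * v) = (a *: u) * v.
Proof.
elim/rclassW: u => t; elim/rclassW: v => u.
by rewrite -rclassM -!rclassZ -rclassM; apply/rclassP/req_scaleAl.
Qed.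

HB.instance Definition _ := GRing.Lmodule_isLalgebra.Build K repalg
  repalg_scaleAl.

Lemma repalg_scaleAr (a : K) (u v : repalg) : a *: (u * v) = u * (a *: v).
Proof.
elim/rclassW: u => t; elim/rclassW: v => u.
by rewrite -rclassM -!rclassZ -rclassM; apply/rclassP/req_scaleAr.
Qed.

HB.instance Definition _ := GRing.Lalgebra_isAlgebra.Build K repalg
  repalg_scaleAr.

Definition rgen (x : A) (b : B) : repalg := rclass (RGen x b).

Lemma rgen_linearl a x y b : rgen (a *: x + y) b = a *: rgen x b + rgen y b.
Proof. by rewrite /rgen -rclassZ -rclassD; apply/rclassP/req_gen_linearl. Qed.

Lemma rgen_linearr a x b c : rgen x (a *: b + c) = a *: rgen x b + rgen x c.
Proof. by rewrite /rgen -rclassZ -rclassD; apply/rclassP/req_gen_linearr. Qed.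

Lemma rgen_is_bilinear : bilinear_for *:%R *:%R rgen.
Proof.
by split=> [v a u u'|u a v v']; [apply: rgen_linearl | apply: rgen_linearr].
Qed.

HB.instance Definition _ :=
  bilinear_isBilinear.Build K A B repalg *:%R *:%R rgen rgen_is_bilinear.

Lemma rclass_sum s : rclass (rsum s) = \sum_(t <- s) rclass t.
Proof. by elim: s => [|t s IH] /=; rewrite ?big_nil // big_cons rclassD IH. Qed.

Lemma rgen_mull x y b (s : seq (B * B)) : comul b = \sum_(p <- s) p.1 \ox p.2 ->
  rgen (x * y) b = \sum_(p <- s) rgen x p.1 * rgen y p.2.
Proof.
move=> /(req_gen_mull x y)/rclassP; rewrite rclass_sum big_map => E.
by rewrite [LHS]E; apply: eq_bigr => p _; rewrite rclassM.
Qed.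

Lemma rgen_mulr x b c (s : seq (A * A)) : comul x = \sum_(p <- s) p.1 \ox p.2 ->
  rgen x (b * c) = \sum_(p <- s) rgen p.1 b * rgen p.2 c.
Proof.
move=> /(req_gen_mulr b c)/rclassP; rewrite rclass_sum big_map => E.
by rewrite [LHS]E; apply: eq_bigr => p _; rewrite rclassM.
Qed.

Lemma rgen_1l b : rgen 1 b = counit b *: 1.
Proof. by rewrite /rgen -rclassZ; apply/rclassP/req_gen_1l. Qed.

Lemma rgen_1r x : rgen x 1 = counit x *: 1.
Proof. by rewrite /rgen -rclassZ; apply/rclassP/req_gen_1r. Qed.

Lemma rgen_comm (x y : homog A) (b c : homog B) :
  rgen (hval x) (hval b) * rgen (hval y) (hval c) =
  ksign (('|x| + '|b|) * ('|y| + '|c|)) *: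
    (rgen (hval y) (hval c) * rgen (hval x) (hval b)).
Proof. by rewrite /rgen -!rclassM -rclassZ; apply/rclassP/req_gen_comm. Qed.

End Representation.

Section RepresentationGrading.
Variables (K : comNzRingType) (A B : gradedBialgType K).
Notation R := (repalg A B).

(* The degree [n] part is spanned by the products of generators x_b, with x and
   b homogeneous, whose degrees |x| + |b| add up to [n]. *)
Inductive repalg_gr : int -> R -> Prop :=
| repalg_gr_0 n : repalg_gr n 0
| repalg_gr_linear n a u v :
    repalg_gr n u -> repalg_gr n v -> repalg_gr n (a *: u + v)
| repalg_gr_1 : repalg_gr 0 1
| repalg_gr_M m n u v :
    repalg_gr m u -> repalg_gr n v -> repalg_gr (m + n) (u * v)
| repalg_gr_gen p q (x : A) (b : B) :
    gr p x -> gr q b -> repalg_gr (p + q) (rgen x b).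

(* Independence of the graded parts is proved by letting R act on the maps
   [int -> R] so that u of degree p sends [f] to [fun n => u * f (n - p)]. *)
Lemma eq_big_all (T : Type) (W : nmodType) (P : pred T) (s : seq T)
  (F G : T -> W) : all P s -> (forall i, P i -> F i = G i) ->
  \sum_(i <- s) F i = \sum_(i <- s) G i.
Proof.
move=> + FG; elim: s => [|i s IH] /=; first by rewrite !big_nil.
by case/andP=> /FG Ei /IH Es; rewrite !big_cons Ei Es.
Qed.

Definition gen_shift (x : A) (b : B) (f : int -> R) (n : int) : R :=
  homog_sum (fun p x => homog_sum (fun q b => rgen x b * f (n - (p + q))) b) x.

Let rgenP a x y (b : B) : rgen (a *: x + y) b = a *: rgen x b + rgen y b :> R.
Proof. exact: rgen_linearl. Qed.

Lemma gen_shift_lin_in f n (x : A) (p q : int) :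
  linear (fun b : B => rgen x b * f (n - (p + q))).
Proof. by move=> a b c /=; rewrite rgen_linearr mulrDl scalerAl. Qed.

Lemma gen_shift_lin_out f n (b : B) (p : int) :
  linear (fun x : A => homog_sum (fun q b => rgen x b * f (n - (p + q))) b).
Proof.
move=> a x y /=; rewrite /homog_sum scaler_sumr -big_split /=.
by apply: eq_bigr => h _; rewrite rgenP mulrDl scalerAl.
Qed.

Lemma gen_shift_linearl f n b : linear (fun x => gen_shift x b f n).
Proof. by apply: homog_sum_linear => p; apply: gen_shift_lin_out. Qed.

Lemma gen_shift_linearr f n x : linear (fun b => gen_shift x b f n).
Proof.
have E b : gen_shift x b f n = \sum_(h <- homog_seq x)
  homog_sum (fun q b => rgen (hval h) b * f (n - ('|h| + q))) b by [].
move=> a b c; rewrite !E scaler_sumr -big_split /=; apply: eq_bigr => h _.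
by apply: homog_sum_linear => q; apply: gen_shift_lin_in.
Qed.

Lemma gen_shift_linear x b a f g n :
  gen_shift x b (fun k => a *: f k + g k) n =
  a *: gen_shift x b f n + gen_shift x b g n.
Proof.
rewrite /gen_shift /homog_sum scaler_sumr -big_split /=.
apply: eq_bigr => h _; rewrite scaler_sumr -big_split /=.
by apply: eq_bigr => k _; rewrite mulrDr scalerAr.
Qed.

Lemma gen_shift_homog p q x b f n : gr p x -> gr q b ->
  gen_shift x b f n = rgen x b * f (n - (p + q)).
Proof.
move=> xp bq; rewrite /gen_shift.
rewrite (homog_sum_homog (fun p => @gen_shift_lin_out f n b p) xp).
by rewrite (homog_sum_homog (fun q => @gen_shift_lin_in f n x p q) bq).
Qed.

Lemma linear_homog_eq (C : gradedAlgType K) (W : lmodType K) (F G : C -> W) :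
  linear F -> linear G -> (forall p x, gr p x -> F x = G x) -> F =1 G.
Proof.
move=> F_lin G_lin FG x.
have E (H : C -> W) : linear H -> H x = \sum_(h <- homog_seq x) H (hval h).
  move=> H_lin; rewrite {1}[x]homog_seqE.
  have HD u v : H (u + v) = H u + H v.
    by have := H_lin 1 u v; rewrite /= !scale1r.
  have H0 : H 0 = 0 by apply: (@addrI _ (H 0)); rewrite -HD !addr0.
  exact: (big_morph H HD H0).
by rewrite !E //; apply: eq_bigr => h _; apply: FG (hvalP h).
Qed.

Fixpoint rterm_shift (t : rterm A B) (f : int -> R) (n : int) : R :=
  match t with
  | RGen x b => gen_shift x b f n
  | RZero => 0
  | ROne => f n
  | RAdd t u => rterm_shift t f n + rterm_shift u f n
  | RMul t u => rterm_shift t (rterm_shift u f) n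
  | RScale a t => a *: rterm_shift t f n
  end.

Lemma rterm_shift_linear t a f g n :
  rterm_shift t (fun k => a *: f k + g k) n =
  a *: rterm_shift t f n + rterm_shift t g n.
Proof.
elim: t f g n => [x b|||t IHt u IHu|t IHt u IHu|c t IHt] f g n /=.
- exact: gen_shift_linear.
- by rewrite scaler0 addr0.
- by [].
- by rewrite IHt IHu scalerDr addrACA.
- by rewrite -IHt; congr (rterm_shift t _ n); apply/funext => k.
- by rewrite IHt scalerDr !scalerA mulrC.
Qed.

Lemma rterm_shift_sum s f n :
  rterm_shift (rsum s) f n = \sum_(t <- s) rterm_shift t f n.
Proof. by elim: s => [|t s IH] /=; rewrite ?big_nil // big_cons IH. Qed.

Lemma gen_shift_mull x y b (s : seq (B * B)) f n :
  comul b = \sum_(p <- s) p.1 \ox p.2 ->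
  gen_shift (x * y) b f n =
  \sum_(p <- s) gen_shift x p.1 (gen_shift y p.2 f) n.
Proof.
have bil x' y' : bilinear_for *:%R *:%R
    (fun u v => gen_shift x' u (gen_shift y' v f) n).
  split=> [v a u u'|u a v v'] /=; first exact: gen_shift_linearr.
  rewrite -gen_shift_linear; congr (gen_shift _ _ _ _); apply/funext => k.
  exact: gen_shift_linearr.
move=> Eb; rewrite -(tlift_sum (bil x y)) -Eb.
move: b {s Eb} => b.
pose G x y b := tlift (fun u v => gen_shift x u (gen_shift y v f) n) (comul b).
rewrite -[RHS]/(G x y b).
apply: (linear_homog_eq (F := fun x => gen_shift (x * y) b f n)
  (G := fun x => G x y b)) => [a u v|a u v|px {}x xp] /=.
- by rewrite mulrDl -scalerAl; apply: gen_shift_linearl.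
- rewrite /G /tlift scaler_sumr -big_split /=; apply: eq_bigr => p _.
  exact: gen_shift_linearl.
apply: (linear_homog_eq (F := fun y => gen_shift (x * y) b f n)
  (G := fun y => G x y b)) => [a u v|a u v|py {}y yp] /=.
- by rewrite mulrDr -scalerAr; apply: gen_shift_linearl.
- rewrite /G /tlift scaler_sumr -big_split /=; apply: eq_bigr => p _.
  rewrite -gen_shift_linear; congr (gen_shift _ _ _ _); apply/funext => k.
  exact: gen_shift_linearl.
apply: (linear_homog_eq (F := fun b => gen_shift (x * y) b f n)
  (G := fun b => G x y b)) => [a u v|a u v|q {}b bq] /=.
- exact: gen_shift_linearr.
- by rewrite /G linearP; apply: tlift_linear.
have [s Es s_deg] := comul_gr _ _ bq.
have Es' : comul b = \sum_(p <- [seq (hval p.1, hval p.2) | p <- s]) p.1 \ox p.2.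
  by rewrite big_map.
rewrite (gen_shift_homog _ _ (gr_M _ _ _ _ xp yp) bq) (rgen_mull _ _ Es').
rewrite /G Es' (tlift_sum (bil x y)) !big_map mulr_suml /=.
apply: eq_big_all s_deg _ => p /eqP <-.
rewrite (gen_shift_homog _ _ xp (hvalP p.1)) (gen_shift_homog _ _ yp (hvalP p.2)).
by rewrite mulrA; congr (_ * f _); rewrite addrACA opprD addrA.
Qed.

Lemma gen_shift_mulr x b c (s : seq (A * A)) f n :
  comul x = \sum_(p <- s) p.1 \ox p.2 ->
  gen_shift x (b * c) f n =
  \sum_(p <- s) gen_shift p.1 b (gen_shift p.2 c f) n.
Proof.
have bil b' c' : bilinear_for *:%R *:%R
    (fun u v => gen_shift u b' (gen_shift v c' f) n).
  split=> [v a u u'|u a v v'] /=; first exact: gen_shift_linearl.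
  rewrite -gen_shift_linear; congr (gen_shift _ _ _ _); apply/funext => k.
  exact: gen_shift_linearl.
move=> Ex; rewrite -(tlift_sum (bil b c)) -Ex.
move: x {s Ex} => x.
pose G x b c := tlift (fun u v => gen_shift u b (gen_shift v c f) n) (comul x).
rewrite -[RHS]/(G x b c).
apply: (linear_homog_eq (F := fun b => gen_shift x (b * c) f n)
  (G := fun b => G x b c)) => [a u v|a u v|pb {}b bp] /=.
- by rewrite mulrDl -scalerAl; apply: gen_shift_linearr.
- rewrite /G /tlift scaler_sumr -big_split /=; apply: eq_bigr => p _.
  exact: gen_shift_linearr.
apply: (linear_homog_eq (F := fun c => gen_shift x (b * c) f n)
  (G := fun c => G x b c)) => [a u v|a u v|pc {}c cp] /=.
- by rewrite mulrDr -scalerAr; apply: gen_shift_linearr.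
- rewrite /G /tlift scaler_sumr -big_split /=; apply: eq_bigr => p _.
  rewrite -gen_shift_linear; congr (gen_shift _ _ _ _); apply/funext => k.
  exact: gen_shift_linearr.
apply: (linear_homog_eq (F := fun x => gen_shift x (b * c) f n)
  (G := fun x => G x b c)) => [a u v|a u v|q {}x xq] /=.
- exact: gen_shift_linearl.
- by rewrite /G linearP; apply: tlift_linear.
have [s Es s_deg] := comul_gr _ _ xq.
have Es' : comul x = \sum_(p <- [seq (hval p.1, hval p.2) | p <- s]) p.1 \ox p.2.
  by rewrite big_map.
rewrite (gen_shift_homog _ _ xq (gr_M _ _ _ _ bp cp)) (rgen_mulr _ _ Es').
rewrite /G Es' (tlift_sum (bil b c)) !big_map mulr_suml /=.
apply: eq_big_all s_deg _ => p /eqP <-.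
rewrite (gen_shift_homog _ _ (hvalP p.1) bp) (gen_shift_homog _ _ (hvalP p.2) cp).
by rewrite mulrA; congr (_ * f _); rewrite addrACA opprD addrA.
Qed.

Lemma req_shift t u : req t u -> forall f n, rterm_shift t f n = rterm_shift u f n.
Proof.
elim=> {t u} /=.
- by [].
- by move=> t u _ IH f n; rewrite IH.
- by move=> t u v _ IH1 _ IH2 f n; rewrite IH1.
- by move=> t t' u u' _ IH1 _ IH2 f n; rewrite IH1 IH2.
- move=> t t' u u' _ IH1 _ IH2 f n; rewrite IH1.
  by congr (rterm_shift _ _ _); apply/funext => k.
- by move=> a t t' _ IH f n; rewrite IH.
- by move=> t u v f n; rewrite addrA.
- by move=> t u f n; rewrite addrC.
- by move=> t f n; rewrite add0r.
- by move=> t f n; rewrite scaleN1r addNr.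
- by [].
- by [].
- by [].
- by [].
- move=> t u v f n; have := rterm_shift_linear t 1 (rterm_shift u f) (rterm_shift v f) n.
  by rewrite !scale1r => <-; congr (rterm_shift _ _ _); apply/funext => k; rewrite scale1r.
- by move=> a b t f n; rewrite scalerA.
- by move=> t f n; rewrite scale1r.
- by move=> a t u f n; rewrite scalerDr.
- by move=> a b t f n; rewrite scalerDl.
- by [].
- move=> a t u f n; have := rterm_shift_linear t a (rterm_shift u f) (fun=> 0) n.
  have -> : rterm_shift t (fun=> 0) n = 0.
    have := rterm_shift_linear t 1 (fun=> 0) (fun=> 0) n.
    have -> : (fun=> 1 *: 0 + 0) = (fun=> 0) :> (int -> R).
      by apply/funext => k; rewrite scaler0 addr0.
    by rewrite scale1r -[X in X = _]addr0 => /addrI.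
  rewrite addr0 => <-; congr (rterm_shift _ _ _); apply/funext => k.
  by rewrite addr0.
- by move=> a x y b f n; apply: gen_shift_linearl.
- by move=> a x b c f n; apply: gen_shift_linearr.
- by move=> x y b s Eb f n; rewrite (gen_shift_mull _ _ _ _ Eb) rterm_shift_sum big_map.
- move=> b f n; apply: (linear_homog_eq (F := fun b => gen_shift 1 b f n)
    (G := fun b => counit b *: f n)) => [|a u v|q {}b bq] /=.
  + exact: gen_shift_linearr.
  + by rewrite linearP /= scalerDl scalerA.
  rewrite (gen_shift_homog _ _ gr_1 bq) rgen_1l -scalerAl mul1r.
  have [q0|q0] := eqVneq q 0; first by rewrite q0 addr0.
  by rewrite (counit_gr _ _ bq q0) !scale0r.
- by move=> x b c s Ex f n; rewrite (gen_shift_mulr _ _ _ _ Ex) rterm_shift_sum big_map.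
- move=> x f n; apply: (linear_homog_eq (F := fun x => gen_shift x 1 f n)
    (G := fun x => counit x *: f n)) => [|a u v|p {}x xp] /=.
  + exact: gen_shift_linearl.
  + by rewrite linearP /= scalerDl scalerA.
  rewrite (gen_shift_homog _ _ xp gr_1) rgen_1r -scalerAl mul1r.
  have [p0|p0] := eqVneq p 0; first by rewrite p0 addr0.
  by rewrite (counit_gr _ _ xp p0) !scale0r.
- move=> x y b c f n.
  rewrite !(gen_shift_homog _ _ (hvalP _) (hvalP _)) !mulrA rgen_comm -scalerAl.
  by rewrite addrAC.
Qed.

Definition repalg_shift (u : R) : (int -> R) -> int -> R := rterm_shift (repr u).

Lemma repalg_shiftE t f n : repalg_shift (rclass t) f n = rterm_shift t f n.
Proof. exact/req_shift/req_repr. Qed.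

Lemma repalg_shiftP a u v f n :
  repalg_shift (a *: u + v) f n = a *: repalg_shift u f n + repalg_shift v f n.
Proof.
elim/rclassW: u => t; elim/rclassW: v => u.
by rewrite -rclassZ -rclassD !repalg_shiftE.
Qed.

Lemma repalg_shift_gr p u f n : repalg_gr p u ->
  repalg_shift u f n = u * f (n - p).
Proof.
move=> up; elim: up f n => {p u} [p|p a u v _ IHu _ IHv||p q u v _ IHu _ IHv
  |p q x b xp bq] f n.
- by rewrite -[0]/(rclass (RZero A B)) repalg_shiftE /= mul0r.
- by rewrite repalg_shiftP IHu IHv mulrDl scalerAl.
- by rewrite -[1]/(rclass (ROne A B)) repalg_shiftE /= mul1r subr0.
- have E : repalg_shift (u * v) f n = repalg_shift u (repalg_shift v f) n.
    elim/rclassW: u {IHu} => t; elim/rclassW: v {IHv} => u.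
    rewrite -rclassM !repalg_shiftE /=; congr (rterm_shift _ _ _).
    by apply/funext => k; rewrite repalg_shiftE.
  by rewrite E IHu IHv mulrA opprD addrA.
- by rewrite /rgen repalg_shiftE /= (gen_shift_homog _ _ xp bq).
Qed.

Lemma repalg_decomp_seq (u : R) : exists s : seq (int * R),
  (forall h, h \in s -> repalg_gr h.1 h.2) /\ u = \sum_(h <- s) h.2.
Proof.
pose D u := exists s : seq (int * R),
  (forall h, h \in s -> repalg_gr h.1 h.2) /\ u = \sum_(h <- s) h.2.
have D0 : D 0 by exists [::]; rewrite big_nil.
have DD u1 u2 : D u1 -> D u2 -> D (u1 + u2).
  move=> [s [s_gr ->]] [r [r_gr ->]]; exists (s ++ r); rewrite big_cat.
  by split=> // h; rewrite mem_cat => /orP[/s_gr|/r_gr].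
have Dgr p u1 : repalg_gr p u1 -> D u1.
  move=> u1p; exists [:: (p, u1)]; rewrite big_seq1; split=> // h.
  by rewrite inE => /eqP ->.
elim/rclassW: u; elim=> [x b|||t Dt u Du|t [s [s_gr Es]] u [r [r_gr Er]]
  |a t [s [s_gr Es]]].
- rewrite -/(D _) -[rclass _]/(rgen x b) [x]homog_seqE [b]homog_seqE.
  rewrite linear_sumlz; apply: (big_ind D) => // h _.
  rewrite linear_sumr; apply: (big_ind D) => // k _.
  by apply: Dgr; apply: repalg_gr_gen; apply: hvalP.
- exact: D0.
- exact: Dgr repalg_gr_1.
- by rewrite rclassD; apply: DD.
- rewrite rclassM Es Er mulr_suml big_seq; apply: (big_ind D) => // h hs.
  rewrite mulr_sumr big_seq; apply: (big_ind D) => // k kr.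
  by apply: Dgr; apply: repalg_gr_M; [apply: s_gr|apply: r_gr].
- rewrite rclassZ Es scaler_sumr big_seq; apply: (big_ind D) => // h hs.
  apply: (Dgr h.1); rewrite -[_ *: _]addr0.
  by apply: repalg_gr_linear; [apply: s_gr|apply: repalg_gr_0].
Qed.

Lemma repalg_gr_decomp (u : R) : exists (s : seq int) (f : int -> R),
  (forall p, repalg_gr p (f p)) /\ u = \sum_(p <- s) f p.
Proof.
have [s [s_gr ->]] := repalg_decomp_seq u.
exists (undup [seq h.1 | h <- s]), (fun p => \sum_(h <- s | h.1 == p) h.2).
split=> [p|]; last exact: sum_by_degree.
rewrite big_seq_cond; apply: big_ind => [|u1 u2 u1p u2p|h /andP[/s_gr hs /eqP <-] //].
  exact: repalg_gr_0.
by rewrite -[u1]scale1r; apply: repalg_gr_linear.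
Qed.

Lemma repalg_gr_indep (s : seq int) (f : int -> R) : uniq s ->
  (forall p, repalg_gr p (f p)) -> \sum_(p <- s) f p = 0 ->
  forall p, p \in s -> f p = 0.
Proof.
move=> s_uniq f_gr sum0 p ps.
pose d (n : int) : R := (n == 0)%:R.
have shift0 : repalg_shift 0 d p = 0.
  by rewrite -[0]/(rclass (RZero A B)) repalg_shiftE.
have shiftD u v : repalg_shift (u + v) d p = repalg_shift u d p + repalg_shift v d p.
  by have := repalg_shiftP 1 u v d p; rewrite !scale1r.
have := congr1 (fun u => repalg_shift u d p) sum0.
rewrite /= shift0 (big_morph (fun u => repalg_shift u d p) shiftD shift0).
rewrite (bigD1_seq p) //= big1 => [|q qp].
  by rewrite (repalg_shift_gr _ _ (f_gr p)) /d subrr eqxx mulr1 addr0.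
by rewrite (repalg_shift_gr _ _ (f_gr q)) /d subr_eq0 eq_sym (negPf qp) mulr0.
Qed.

HB.instance Definition _ := Algebra_isGraded.Build K (repalg A B)
  repalg_gr_0 repalg_gr_linear repalg_gr_decomp repalg_gr_indep
  repalg_gr_1 repalg_gr_M.

End RepresentationGrading.

Section FoxPairing.
Variables (K : comNzRingType) (A : gradedHopfType K) (n : int).

Definition fox_pairing (rho : {bilinear A -> A -> A}) : Prop :=
  [/\ forall p q x y, gr p x -> gr q y -> gr (p + q + n) (rho x y),
      forall x y z, rho x (y * z) = rho x y * z + counit y *: rho x z
    & forall x y z, rho (x * y) z = counit y *: rho x z + x * rho y z].

(* A junk value when the antipode is not bijective; in a cocommutative Hopf
   algebra the antipode is an involution. *)
Definition antipode_inv (x : A) : A := xget 0 [set y | antipode y = x].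

Definition fox_transpose (rho : {bilinear A -> A -> A}) (x y : homog A) : A :=
  ksign (('|x| + n) * ('|y| + n)) *:
    antipode_inv (rho (antipode (hval y)) (antipode (hval x))).

Definition fox_antisymmetric (rho : {bilinear A -> A -> A}) : Prop :=
  forall x y : homog A, fox_transpose rho x y = - rho (hval x) (hval y).

End FoxPairing.

Section Biderivation.
Variables (K : comNzRingType) (B : gradedHopfType K).

Definition biderivation (bul : {bilinear B -> B -> K | *%R & *%R}) : Prop :=
  (forall b c d, bul (b * c) d = counit b * bul c d + counit c * bul b d) /\
  (forall b c d, bul b (c * d) = counit c * bul b d + counit d * bul b c).

Definition balanced (bul : {bilinear B -> B -> K | *%R & *%R}) : Prop :=
  forall b c : B,
    sweedler3 (fun c1 c2 c3 => bul b c2 *: (antipode c1 * c3)) c =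
    sweedler3 (fun b1 b2 b3 => bul c b2 *: (antipode b3 * b1)) b.

End Biderivation.

Section Bracket.
Variables (K : comNzRingType) (R : gradedAlgType K) (n : int).

Definition graded_bracket (br : {bilinear R -> R -> R}) : Prop :=
  [/\ forall p q x y, gr p x -> gr q y -> gr (p + q + n) (br x y),
      forall x y z : homog R, br (hval x) (hval y * hval z) =
        br (hval x) (hval y) * hval z +
        ksign (('|x| + n) * '|y|) *: (hval y * br (hval x) (hval z))
    & forall x y z : homog R, br (hval x * hval y) (hval z) =
        hval x * br (hval y) (hval z) +
        ksign ('|y| * ('|z| + n)) *: (br (hval x) (hval z) * hval y)].

Definition bracket_antisymmetric (br : {bilinear R -> R -> R}) : Prop :=
  forall x y : homog R, br (hval x) (hval y) =
    - (ksign (('|x| + n) * ('|y| + n)) *: br (hval y) (hval x)).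

End Bracket.

(* {x_b, y_c} = (-1)^(|x''||y'|_n) (c'' . b2) rho(x', y')_(s(b3) b1) x''_b4 y''_c'
   for all expansions [X], [Y] of the coproducts of x, y with homogeneous terms. *)
Definition fox_bracket_formula (K : comNzRingType) (A B : gradedHopfType K)
    (n : int) (rho : {bilinear A -> A -> A})
    (bul : {bilinear B -> B -> K | *%R & *%R})
    (br : {bilinear repalg A B -> repalg A B -> repalg A B}) : Prop :=
  forall (x y : A) (b c : B) (X Y : seq (homog A * homog A)),
  hexp (comul x) X -> hexp (comul y) Y ->
  br (rgen x b) (rgen y c) =
  \sum_(p <- X) \sum_(q <- Y)
    let: (x1, x2) := p in let: (y1, y2) := q in
    sweedler4 (fun b1 b2 b3 b4 => sweedler2 (fun c1 c2 =>
      (ksign ('|x2| * ('|y1| + n)) * bul c2 b2) *: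
        (rgen (rho (hval x1) (hval y1)) (antipode b3 * b1)
         * rgen (hval x2) b4 * rgen (hval y2) c1)) c) b.

(* Main.v *)
From HB Require Import structures.
Require Import Defs.
From mathcomp Require Import all_boot all_order all_algebra sesquilinear.
From mathcomp Require Import boolp classical_sets.
From mathcomp Require Import zify ring.

Set Implicit Arguments.
Unset Strict Implicit.
Unset Printing Implicit Defensive.
Import GRing.Theory.
Local Open Scope ring_scope.

(** A graded bracket is a derivation in each argument, so it is determined by its
    values on the generators x_b; the point is that the prescribed values are
    compatible with the relations of the representation algebra.

    Let coad(r, b, c) be the sum of the (c . b'') r_(s(b''') b').  Since [A] is
    cocommutative and the representation algebra is graded commutative, the
    prescribed value of {x_b, y_c} is also the sum, without any sign, of the
      x'_(b'') coad(rho(x'', y'), b', c'') y''_(c')          ([fox_gen_formula]).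
    All the computations are done with this expression, called [fox_gen], and they
    rest on four facts about coad.
    - It is a derivation in c, because the form is a biderivation ([coadM]).
    - It can be expanded over c instead of b: this is what balanced means
      ([coad_balanced]).
    - A factor z of r can be absorbed: the sum of the coad(r z', b, c'') z''_(c')
      is the sum of the coad(r, b, c') z_(c''), because the antipodes cancel once
      coad is expanded over c and [B] is commutative ([coad_absorbr]).  Expanding
      over b gives the mirror image [coad_absorbl].
    - Replacing r by s(r) exchanges b and c ([coad_antipode]).
    The relations for y_(cd) and (yz)_c then follow from the first fact and
    cocommutativity, and from the Fox derivation rule and the third fact.  The
    values are antisymmetric because rho is, because rho(s(x), s(y)) expands as
    s(x') rho(x'', y') s(y''), and because the two antipodes are absorbed.

    It remains to extend antisymmetric values from the generators, and this has
    nothing to do with Fox pairings ([bracket_of_generators]).  For fixed x_b the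
    values are the data of a derivation {x_b, -} of the representation algebra.
    By antisymmetry this gives {u, y_c} for every u, and the identity
      {uv, y_c} = u {v, y_c} + (-1)^(|u||v|) v {u, y_c},
    whose sign depends neither on y nor on c, shows by induction on u that the
    {u, y_c} are again the data of a derivation {u, -}.  The Leibniz rule in u and
    antisymmetry are equalities of derivations, checked on generators. *)

(** * Linear maps *)

Definition is_linear (K : comNzRingType) (U W : lmodType K) (f : U -> W) : Prop :=
  forall a u v, f (a *: u + v) = a *: f u + f v.

Definition is_bilinear (K : comNzRingType) (U V W : lmodType K)
    (F : U -> V -> W) : Prop :=
  (forall v, is_linear (F^~ v)) /\ (forall u, is_linear (F u)).

Definition is_trilinear (K : comNzRingType) (U V V' W : lmodType K)
    (F : U -> V -> V' -> W) : Prop :=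
  [/\ forall v w, is_linear (fun u => F u v w),
      forall u w, is_linear (fun v => F u v w)
    & forall u v, is_linear (F u v)].

Notation "\cop [ u , v <- x ] E" := (sweedler2 (fun u v => E) x)
  (at level 36, u name, v name, E at level 36, x at level 10,
   format "\cop [ u ,  v  <-  x ]  E").

Section LinearFunctions.
Variable K : comNzRingType.
Implicit Types U V W : lmodType K.

Lemma lin_id U : is_linear (fun u : U => u).
Proof. by []. Qed.

Lemma lin_0 U W : is_linear (fun _ : U => 0 : W).
Proof. by move=> a u v; rewrite scaler0 addr0. Qed.

Lemma lin_app U V W (g : V -> W) (f : U -> V) :
  is_linear g -> is_linear f -> is_linear (fun u => g (f u)).
Proof. by move=> gl fl a u v; rewrite fl gl. Qed.

Lemma lin_add U W (f g : U -> W) :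
  is_linear f -> is_linear g -> is_linear (fun u => f u + g u).
Proof. by move=> fl gl a u v; rewrite fl gl scalerDr addrACA. Qed.

Lemma lin_scale U W a (f : U -> W) : is_linear f -> is_linear (fun u => a *: f u).
Proof. by move=> fl b u v; rewrite fl scalerDr !scalerA mulrC. Qed.

Lemma lin_opp U W (f : U -> W) : is_linear f -> is_linear (fun u => - f u).
Proof. by move=> fl b u v; rewrite fl opprD scalerN. Qed.

Lemma lin_sum U W I (s : seq I) (P : pred I) (F : U -> I -> W) :
  (forall i, is_linear (F^~ i)) -> is_linear (fun u => \sum_(i <- s | P i) F u i).
Proof.
move=> Fl a u v; rewrite scaler_sumr -big_split /=; apply: eq_bigr => i _.
exact: Fl.
Qed.

Lemma lin_mull U (A : algType K) (f : U -> A) c :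
  is_linear f -> is_linear (fun u => f u * c).
Proof. by move=> fl a u v; rewrite fl mulrDl scalerAl. Qed.

Lemma lin_mulr U (A : algType K) (f : U -> A) c :
  is_linear f -> is_linear (fun u => c * f u).
Proof. by move=> fl a u v; rewrite fl mulrDr scalerAr. Qed.

Lemma lin_linear U V W (g : {linear V -> W}) (f : U -> V) :
  is_linear f -> is_linear (fun u => g (f u)).
Proof. by move=> fl a u v; rewrite fl linearP. Qed.

Lemma lin_bill U V V' W (g : {bilinear V -> V' -> W}) (f : U -> V) c :
  is_linear f -> is_linear (fun u => g (f u) c).
Proof. by move=> fl a u v; rewrite fl linearPl. Qed.

Lemma lin_bilr U V V' W (g : {bilinear V -> V' -> W}) (f : U -> V') c :
  is_linear f -> is_linear (fun u => g c (f u)).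
Proof. by move=> fl a u v; rewrite fl linearPr. Qed.

Lemma lin_formlZ U V V' W (g : {bilinear V -> V' -> K | *%R & *%R})
    (f : U -> V) c (w : W) :
  is_linear f -> is_linear (fun u => g (f u) c *: w).
Proof. by move=> fl a u v; rewrite fl linearPl scalerDl scalerA. Qed.

Lemma lin_formrZ U V V' W (g : {bilinear V -> V' -> K | *%R & *%R})
    (f : U -> V') c (w : W) :
  is_linear f -> is_linear (fun u => g c (f u) *: w).
Proof. by move=> fl a u v; rewrite fl linearPr scalerDl scalerA. Qed.

Lemma lin_counitZ U (C : gradedBialgType K) W (f : U -> C) (w : W) :
  is_linear f -> is_linear (fun u => counit (f u) *: w).
Proof. by move=> fl a u v; rewrite fl linearP scalerDl scalerA. Qed.

Lemma linear_funD U W (f : U -> W) u v : is_linear f -> f (u + v) = f u + f v.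
Proof. by move=> fl; have := fl 1 u v; rewrite !scale1r. Qed.

Lemma linear_fun0 U W (f : U -> W) : is_linear f -> f 0 = 0.
Proof. by move=> fl; apply: (@addrI _ (f 0)); rewrite -linear_funD // !addr0. Qed.

Lemma linear_funZ U W (f : U -> W) a u : is_linear f -> f (a *: u) = a *: f u.
Proof. by move=> fl; rewrite -[X in f X]addr0 fl linear_fun0 // addr0. Qed.

Lemma linear_funN U W (f : U -> W) u : is_linear f -> f (- u) = - f u.
Proof. by move=> fl; rewrite -scaleN1r linear_funZ // scaleN1r. Qed.

Lemma linear_fun_sum U W (f : U -> W) I (s : seq I) (P : pred I) F : is_linear f ->
  f (\sum_(i <- s | P i) F i) = \sum_(i <- s | P i) f (F i).
Proof.
move=> fl; apply: (big_morph f) => [u v|]; [exact: linear_funD|exact: linear_fun0].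
Qed.

Lemma is_bilinearW U V W (F : U -> V -> W) :
  is_bilinear F -> bilinear_for *:%R *:%R F.
Proof. by case. Qed.

Lemma tlift_pure U V W (f : U -> V -> W) u v : is_bilinear f -> tlift f (u \ox v) = f u v.
Proof.
by move=> /is_bilinearW fb; have := tlift_sum fb [:: (u, v)]; rewrite !big_seq1.
Qed.

Lemma lin_tlift U V W (T : lmodType K) (f : U -> V -> W) (g : T -> tensor U V) :
  is_bilinear f -> is_linear g -> is_linear (fun t => tlift f (g t)).
Proof. by move=> fb gl a u v; rewrite gl; apply: (tlift_linear (is_bilinearW fb)). Qed.

End LinearFunctions.

Section SweedlerLinear.
Variables (K : comNzRingType) (C : gradedBialgType K) (U W : lmodType K).

Lemma lin_sw2 (F : U -> C -> C -> W) x :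
  (forall a b, is_linear (fun u => F u a b)) -> is_linear (fun u => sweedler2 (F u) x).
Proof. by move=> Fl; apply: (@lin_sum _ _ _ _ _ _ (fun u p => F u p.1 p.2)). Qed.

Lemma lin_sw2_arg (F : C -> C -> W) (f : U -> C) :
  is_bilinear F -> is_linear f -> is_linear (fun u => sweedler2 F (f u)).
Proof. by move=> Fb fl; apply: lin_tlift => //; apply: lin_linear. Qed.

End SweedlerLinear.

(** Decides linearity from the syntax of a function; hypotheses supply the
    linearity of local functions in each of their arguments. *)
Ltac lin :=
  match goal with |- is_linear ?f => change (is_linear (fun u => f u)) end;
  cbv beta; first
  [ assumption
  | match goal with
    | H : forall _, is_linear _ |- is_linear _ => by apply: H
    | H : forall _ _, is_linear _ |- is_linear _ => by apply: H
    end
  | exact: lin_id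
  | exact: lin_0
  | match goal with
    | |- is_linear (fun u => sweedler2 ?F _) => apply: lin_sw2_arg; [bilin_tac | lin]
    | |- is_linear (fun u => sweedler2 _ _) => apply: lin_sw2 => ? ?; lin
    | |- is_linear (fun u => _ + _) => apply: lin_add; lin
    | |- is_linear (fun u => - _) => apply: lin_opp; lin
    | |- is_linear (fun u => \sum_(i <- _ | _) _) => apply: lin_sum => ?; lin
    | |- is_linear (fun u => _ * _) => first [apply: lin_mull | apply: lin_mulr]; lin
    | |- is_linear (fun u => _ *: _) =>
        first [apply: lin_scale | apply: lin_counitZ | apply: lin_formlZ
          | apply: lin_formrZ]; lin
    | H : forall v, is_linear (fun u => ?G u v) |- is_linear (fun u => ?G _ _) =>
        apply: (lin_app (H _)); lin
    | H : forall v, is_linear (?G v) |- is_linear (fun u => ?G _ _) =>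
        apply: (lin_app (H _)); lin
    | H : forall v w, is_linear (fun u => ?G u v w) |- is_linear (fun u => ?G _ _ _) =>
        apply: (lin_app (H _ _)); lin
    | H : forall v w, is_linear (fun u => ?G v u w) |- is_linear (fun u => ?G _ _ _) =>
        apply: (lin_app (H _ _)); lin
    | H : forall v w, is_linear (?G v w) |- is_linear (fun u => ?G _ _ _) =>
        apply: (lin_app (H _ _)); lin
    | H : is_linear ?g |- is_linear (fun u => ?g _) => apply: (lin_app H); lin
    end
  | apply: lin_bill; lin
  | apply: lin_bilr; lin
  | apply: lin_linear; lin ]
with bilin_tac := first [assumption | split => [?|?]; lin].
Ltac trilin_tac := split => [? ?|? ?|? ?]; lin.

(** * Sweedler calculus *)

Section Sweedler2.
Variables (K : comNzRingType) (C : gradedBialgType K) (W : lmodType K).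
Implicit Types (F G : C -> C -> W) (x : C).

Lemma eq_sw2 (W' : nmodType) (F G : C -> C -> W') x :
  (forall u v, F u v = G u v) -> sweedler2 F x = sweedler2 G x.
Proof. by move=> FG; apply: eq_bigr => p _; apply: FG. Qed.

Lemma sw2E F x s : is_bilinear F -> comul x = \sum_(p <- s) p.1 \ox p.2 ->
  sweedler2 F x = \sum_(p <- s) F p.1 p.2.
Proof. by move=> Fb Ex; rewrite /sweedler2 Ex tlift_sum //; apply: is_bilinearW. Qed.

Lemma sw2_hexp F x s : is_bilinear F -> hexp (comul x) s ->
  sweedler2 F x = \sum_(p <- s) F (hval p.1) (hval p.2).
Proof.
move=> Fb Ex; rewrite (@sw2E _ _ [seq (hval p.1, hval p.2) | p <- s]) ?big_map //.
Qed.

Lemma sw2Dl F G x :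
  \cop[u, v <- x] (F u v + G u v) = \cop[u, v <- x] F u v + \cop[u, v <- x] G u v.
Proof. exact: big_split. Qed.

Lemma sw2Z a F x : \cop[u, v <- x] (a *: F u v) = a *: \cop[u, v <- x] F u v.
Proof. by rewrite [RHS]scaler_sumr. Qed.

Lemma sw2N F x : \cop[u, v <- x] (- F u v) = - \cop[u, v <- x] F u v.
Proof. by rewrite [LHS]sumrN. Qed.

Lemma sw2_linear (V : lmodType K) (f : V -> W) (F : C -> C -> V) x : is_linear f ->
  f (\cop[u, v <- x] F u v) = \cop[u, v <- x] f (F u v).
Proof. by move=> fl; apply: linear_fun_sum. Qed.

Lemma sw2_coassoc (F : C -> C -> C -> W) x : is_trilinear F ->
  \cop[u, v <- x] \cop[a, b <- u] F a b v = \cop[u, v <- x] \cop[a, b <- v] F u a b.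
Proof.
case=> F1 F2 F3.
have Fb w : is_bilinear (fun u v => F u v w) by bilin_tac.
have Tb : is_bilinear (fun t w => tlift (fun u v => F u v w) t).
  split=> [v|u]; first by apply: lin_tlift.
  by apply: (@lin_sum _ _ _ _ _ _ (fun w p => F p.1 p.2 w)) => p; lin.
set T := tlift (fun t w => tlift (fun u v => F u v w) t).
have Tl : is_linear T by apply: lin_tlift.
have Ab (a : C) : is_bilinear (fun v w : C => (a \ox v) \ox w).
  by split=> [v|u] b y z; rewrite !(linearPr, linearPl).
have Gb : is_bilinear
    (fun (u : C) t => tlift (fun v w : C => (u \ox v) \ox w) t).
  split=> [v|u]; last by apply: lin_tlift.
  apply: (@lin_sum _ _ _ _ _ _ (fun u p => (u \ox p.1) \ox p.2)) => q b y z.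
  by rewrite !linearPl.
have Gl : is_linear (@tassoc K C C C) by apply: lin_tlift.
have Eassoc : tassoc (tmap id comul (comul x)) =
    \sum_(p <- repr (comul x))
      tlift (fun v w : C => (p.1 \ox v) \ox w) (comul p.2).
  rewrite /tmap {1}/tlift (linear_fun_sum _ _ _ Gl).
  by apply: eq_bigr => p _; rewrite /tassoc tlift_pure.
have := congr1 T (comul_coassoc x).
rewrite Eassoc /tmap {1}/tlift !(linear_fun_sum _ _ _ Tl) => E.
transitivity (\sum_(p <- repr (comul x)) T (comul p.1 \ox p.2)).
  by apply: eq_bigr => p _; rewrite /T tlift_pure.
rewrite E; apply: eq_bigr => p _.
rewrite {1}/tlift (linear_fun_sum _ _ _ Tl); apply: eq_bigr => q _.
by rewrite /T !tlift_pure.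
Qed.

Lemma sw2_counitl (f : C -> W) x :
  is_linear f -> \cop[u, v <- x] (counit u *: f v) = f x.
Proof.
move=> fl; rewrite -[in RHS](counit_comull x) /tlift (linear_fun_sum _ _ _ fl).
by apply: eq_bigr => p _; rewrite linear_funZ.
Qed.

Lemma sw2_counitr (f : C -> W) x :
  is_linear f -> \cop[u, v <- x] (counit v *: f u) = f x.
Proof.
move=> fl; rewrite -[in RHS](counit_comulr x) /tlift (linear_fun_sum _ _ _ fl).
by apply: eq_bigr => p _; rewrite linear_funZ.
Qed.

Lemma sw2_exchange (C' : gradedBialgType K) (F : C -> C -> C' -> C' -> W) x y :
  \cop[u, v <- x] \cop[a, b <- y] F u v a b =
  \cop[a, b <- y] \cop[u, v <- x] F u v a b.
Proof. exact: exchange_big. Qed.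

Lemma sw2_sum I (r : seq I) (F : I -> C -> C -> W) x :
  \sum_(i <- r) \cop[u, v <- x] F i u v = \cop[u, v <- x] \sum_(i <- r) F i u v.
Proof. exact: exchange_big. Qed.

Lemma sw2_1 F : is_bilinear F -> sweedler2 F 1 = F 1 1.
Proof. by move=> Fb; rewrite /sweedler2 comul1 tlift_pure. Qed.

End Sweedler2.

Section Sweedler2Mul.
Variables (K : comNzRingType) (C : gradedBialgType K) (R : algType K).

Lemma sw2_mull (F : C -> C -> R) r x :
  (\cop[u, v <- x] F u v) * r = \cop[u, v <- x] (F u v * r).
Proof. exact: mulr_suml. Qed.

Lemma sw2_mulr (F : C -> C -> R) r x :
  r * (\cop[u, v <- x] F u v) = \cop[u, v <- x] (r * F u v).
Proof. exact: mulr_sumr. Qed.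

End Sweedler2Mul.

(** * Koszul signs and gradings *)

Section KoszulSigns.
Variable K : comNzRingType.

Definition parity (m : int) : bool := odd `|m|%N.

Lemma parityD m n : parity (m + n) = parity m (+) parity n.
Proof. rewrite /parity; lia. Qed.

Lemma parityM m n : parity (m * n) = parity m && parity n.
Proof. by rewrite /parity abszM oddM. Qed.

Lemma parityN m : parity (- m) = parity m.
Proof. by rewrite /parity abszN. Qed.

Lemma ksignE m : ksign m = (-1) ^+ parity m :> K.
Proof. by rewrite signr_odd. Qed.

Lemma ksign_eq m n : parity m = parity n -> ksign m = ksign n :> K.
Proof. by rewrite !ksignE => ->. Qed.

Lemma ksignD m n : ksign (m + n) = ksign m * ksign n :> K.
Proof. by rewrite !ksignE parityD signr_addb. Qed.

Lemma ksign0 : ksign 0 = 1 :> K.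
Proof. by []. Qed.

Lemma ksign_sqr m : ksign m * ksign m = 1 :> K.
Proof. by rewrite -ksignD (@ksign_eq _ 0) // parityD addbb. Qed.

End KoszulSigns.

(** Compares two products of signs by running through the parities of the degrees. *)
Ltac ksign_tac := rewrite ?scalerA -?ksignD; first
  [ congr (_ *: _); apply: ksign_eq | congr (- (_ *: _)); apply: ksign_eq
  | apply: ksign_eq];
  rewrite ?(parityD, parityM, parityN) /=; 
  repeat match goal with |- context [parity ?m] => case: (parity m) end;
  reflexivity.

Section Grading.
Variables (K : comNzRingType) (A : gradedAlgType K).
Implicit Types (x y : A) (p q d : int).

Lemma homog_eq (W : lmodType K) (F G : A -> W) : is_linear F -> is_linear G ->
  (forall p x, gr p x -> F x = G x) -> F =1 G.
Proof. exact: linear_homog_eq. Qed.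

Lemma gr_eq p q x : gr p x -> p = q -> gr q x.
Proof. by move=> xp <-. Qed.

Lemma grZ p a x : gr p x -> gr p (a *: x).
Proof. by move=> xp; rewrite -[_ *: _]addr0; apply: gr_linear => //; apply: gr_0. Qed.

Lemma grD p x y : gr p x -> gr p y -> gr p (x + y).
Proof. by move=> xp yp; rewrite -[x]scale1r; apply: gr_linear. Qed.

Lemma grN p x : gr p x -> gr p (- x).
Proof. by rewrite -scaleN1r; apply: grZ. Qed.

Lemma gr_disjoint p q x : gr p x -> gr q x -> p != q -> x = 0.
Proof.
move=> xp xq pq; pose f r := if r == p then x else if r == q then - x else 0.
have /= := @gr_indep _ A [:: p; q] f; rewrite !big_cons big_nil /f eqxx.
rewrite [q == p]eq_sym (negPf pq) eqxx addr0 subrr inE pq.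
move=> /(_ erefl _ erefl p); rewrite eqxx mem_head; apply=> // r.
by case: eqP => [-> //|_]; case: eqP => [->|_]; [apply: grN|apply: gr_0].
Qed.

(** With this operator the Leibniz rule of a derivation of degree [d] can be written
    for inhomogeneous elements as well. *)
Definition gsign d : A -> A := homog_sum (fun p x => ksign (d * p) *: x).

Lemma gsign_linear d : is_linear (gsign d).
Proof. by apply: homog_sum_linear => p; apply: lin_scale. Qed.

Lemma gsign_homog d p x : gr p x -> gsign d x = ksign (d * p) *: x.
Proof.
by apply: (homog_sum_homog (F := fun p x => ksign (d * p) *: x)) => q;
  apply: lin_scale.
Qed.

Lemma gsign1 d : gsign d 1 = 1.
Proof. by rewrite (gsign_homog _ gr_1) mulr0 scale1r. Qed.

Lemma gsignM d x y : gsign d (x * y) = gsign d x * gsign d y.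
Proof.
move: x; apply: homog_eq => [||p x xp].
- exact/(lin_app (gsign_linear d))/lin_mull.
- exact/lin_mull/gsign_linear.
move: y; apply: homog_eq => [||q y yq].
- exact/(lin_app (gsign_linear d))/lin_mulr.
- exact/lin_mulr/gsign_linear.
rewrite (gsign_homog _ (gr_M _ _ _ _ xp yq)) !(gsign_homog _ xp, gsign_homog _ yq).
by rewrite -scalerAl -scalerAr mulrDr; ksign_tac.
Qed.

Lemma gsign_comm d q u x : graded_commutative A -> gr q u ->
  gsign (q + d) x * u = u * gsign d x.
Proof.
move=> Ac uq; move: x; apply: homog_eq => [||p x xp].
- exact/lin_mull/gsign_linear.
- exact/lin_mulr/gsign_linear.
rewrite !(gsign_homog _ xp) -scalerAl -scalerAr.
have /= -> := Ac (Homog xp) (Homog uq); ksign_tac.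
Qed.

End Grading.

Lemma hexp_exists (K : comNzRingType) (A B : gradedAlgType K) (t : tensor A B) :
  exists s, hexp t s.
Proof.
pose D t := exists s : seq (homog A * homog B), hexp t s.
have DD t1 t2 : D t1 -> D t2 -> D (t1 + t2).
  by move=> [s ->] [r ->]; exists (s ++ r); rewrite /hexp big_cat.
have D0 : D 0 by exists [::]; rewrite /hexp big_nil.
rewrite -/(D t) [t]tensor_sum_repr; apply: (big_ind D) => // -[u v] _ /=.
rewrite [u]homog_seqE [v]homog_seqE linear_sumlz; apply: (big_ind D) => // h _.
rewrite linear_sumr; apply: (big_ind D) => // k _.
by exists [:: (h, k)]; rewrite /hexp big_seq1.
Qed.

Section GradedSweedler.
Variables (K : comNzRingType) (C : gradedBialgType K).

Lemma gr_sw2 (A : gradedAlgType K) (F : C -> C -> A) p k x :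
  is_bilinear F -> gr p x ->
  (forall q r u v, gr q u -> gr r v -> q + r = p -> gr k (F u v)) ->
  gr k (sweedler2 F x).
Proof.
move=> Fb xp FP; have [s Es s_deg] := comul_gr _ _ xp.
rewrite (sw2_hexp Fb Es); elim: s s_deg {Es} => [|h s IH] /=.
  by rewrite big_nil => _; apply: gr_0.
case/andP=> /eqP hp /IH{}IH; rewrite big_cons; apply: grD => //.
exact: FP (hvalP _) (hvalP _) hp.
Qed.

Lemma sw2_cocomm (W : lmodType K) (F : C -> C -> W) x s : cocommutative C ->
  is_bilinear F -> hexp (comul x) s ->
  sweedler2 F x =
  \sum_(p <- s) ksign ('|p.1| * '|p.2|) *: F (hval p.2) (hval p.1).
Proof.
move=> Cc Fb Es; rewrite /sweedler2 (Cc _ _ Es).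
have Tl : is_linear (tlift F) by apply: lin_tlift.
rewrite (linear_fun_sum _ _ _ Tl); apply: eq_bigr => p _.
by rewrite linear_funZ // tlift_pure.
Qed.

Lemma sw2_mul (W : lmodType K) (F : C -> C -> W) x y s t : is_bilinear F ->
  hexp (comul x) s -> hexp (comul y) t ->
  sweedler2 F (x * y) = \sum_(p <- s) \sum_(q <- t)
    ksign ('|p.2| * '|q.1|) *: F (hval p.1 * hval q.1) (hval p.2 * hval q.2).
Proof.
move=> Fb Es Et; rewrite /sweedler2 (comulM _ _ _ _ Es Et).
have Tl : is_linear (tlift F) by apply: lin_tlift.
rewrite (linear_fun_sum _ _ _ Tl); apply: eq_bigr => p _.
rewrite (linear_fun_sum _ _ _ Tl); apply: eq_bigr => q _.
by rewrite linear_funZ // tlift_pure.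
Qed.

End GradedSweedler.

(** * The antipode *)

Section Antipode.
Variables (K : comNzRingType) (C : gradedHopfType K).
Implicit Types (x y : C).

Lemma sw2_antipodel (W : lmodType K) (f : C -> W) x : is_linear f ->
  \cop[u, v <- x] f (antipode u * v) = counit x *: f 1.
Proof.
by move=> fl; rewrite -(linear_funZ _ _ fl) -antipodel [in RHS]/tlift linear_fun_sum.
Qed.

Lemma sw2_antipoder (W : lmodType K) (f : C -> W) x : is_linear f ->
  \cop[u, v <- x] f (u * antipode v) = counit x *: f 1.
Proof.
by move=> fl; rewrite -(linear_funZ _ _ fl) -antipoder [in RHS]/tlift linear_fun_sum.
Qed.

Lemma antipode1 : antipode (1 : C) = 1.
Proof.
have := antipodel (1 : C); rewrite -/(sweedler2 _ _) sw2_1 ?mulr1.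
  by rewrite rmorph1 scale1r.
by bilin_tac.
Qed.

(** Both sides, as functions of x and y, are convolution inverse to the
    multiplication: the left side from the left and the right side from the right.
    Evaluating a threefold convolution product in two ways identifies them. *)
Lemma antipodeM p q x y : gr p x -> gr q y ->
  antipode (x * y) = ksign (p * q) *: (antipode y * antipode x).
Proof.
move=> xp yq.
(* The factor s(x' y') x'' with the Koszul sign of x'' and y'. *)
pose h x1 x2 : C -> C := homog_sum (fun r v => antipode (x1 * v) * gsign r x2).
have hl r x1 x2 : is_linear (fun v => antipode (x1 * v) * gsign r x2) by lin.
have hE r v x1 x2 : gr r v -> h x1 x2 v = antipode (x1 * v) * gsign r x2.
  exact: (homog_sum_homog (fun r => hl r x1 x2)).
have h3 x1 x2 : is_linear (h x1 x2) := homog_sum_linear (fun r => hl r x1 x2).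
have gl d : is_linear (@gsign K C d) := gsign_linear d.
have h1 x2 v : is_linear (fun x1 => h x1 x2 v).
  apply: (@lin_sum _ _ _ _ _ _
    (fun x1 k => antipode (x1 * hval k) * gsign (hdeg k) x2)) => k; lin.
have h2 x1 v : is_linear (fun x2 => h x1 x2 v).
  apply: (@lin_sum _ _ _ _ _ _
    (fun x2 k => antipode (x1 * hval k) * gsign (hdeg k) x2)) => k; lin.
have inv X Y : \cop[x1, x2 <- X] \cop[y1, y2 <- Y] (h x1 x2 y1 * y2) =
    (counit X * counit Y) *: 1.
  have [s Es] := hexp_exists (comul X); have [t Et] := hexp_exists (comul Y).
  rewrite -rmorphM -antipodel -/(sweedler2 _ _).
  rewrite (sw2_mul _ Es Et); last by bilin_tac.
  rewrite (sw2_hexp _ Es); last by bilin_tac.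
  apply: eq_bigr => a _; rewrite (sw2_hexp _ Et); last by bilin_tac.
  apply: eq_bigr => b _; rewrite (hE _ _ _ _ (hvalP b.1)).
  by rewrite (gsign_homog _ (hvalP a.2)) -scalerAr -scalerAl mulrA mulrC.
transitivity (\cop[X, x3 <- x] \cop[x1, x2 <- X] \cop[Y, y3 <- y]
   \cop[y1, y2 <- Y] (h x1 x2 y1 * y2 * (antipode y3 * gsign q (antipode x3)))).
  rewrite (sw2_coassoc (F := fun x1 x2 x3 => \cop[Y, y3 <- y]
   \cop[y1, y2 <- Y] (h x1 x2 y1 * y2 * (antipode y3 * gsign q (antipode x3)))));
    last by trilin_tac.
  rewrite -(sw2_counitr (f := fun x1 => antipode (x1 * y))); last by lin.
  apply: eq_sw2 => x1 X.
  transitivity (\cop[x2, x3 <- X]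
      (antipode (x1 * y) * gsign q (x2 * antipode x3))).
    rewrite (sw2_antipoder (f := fun z => antipode (x1 * y) * gsign q z)); last by lin.
    by rewrite gsign1 mulr1.
  apply: eq_sw2 => x2 x3.
  rewrite gsignM mulrA -(hE _ _ _ _ yq).
  rewrite (sw2_coassoc (F := fun y1 y2 y3 =>
    h x1 x2 y1 * y2 * (antipode y3 * gsign q (antipode x3)))); last by trilin_tac.
  rewrite -(sw2_counitr (f := fun y1 => h x1 x2 y1 * gsign q (antipode x3)));
    last by lin.
  apply: eq_sw2 => y1 Y.
  under eq_sw2 => y2 y3 do rewrite -mulrA [y2 * _]mulrA.
  rewrite (sw2_antipoder (f := fun z => h x1 x2 y1 * (z * gsign q (antipode x3))));
    last by lin.
  by rewrite mul1r.
transitivity (\cop[X, x3 <- x] (counit X *: (antipode y * gsign q (antipode x3)))).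
  apply: eq_sw2 => X x3.
  rewrite -(sw2_counitl (f := fun y3 => counit X *: (antipode y3 * gsign q (antipode x3))));
    last by lin.
  rewrite sw2_exchange; apply: eq_sw2 => Y y3.
  rewrite scalerA mulrC -[antipode y3 * _]mul1r scalerAl -inv sw2_mull.
  by apply: eq_sw2 => x1 x2; rewrite sw2_mull mul1r.
rewrite (sw2_counitl (f := fun x3 => antipode y * gsign q (antipode x3))); last by lin.
by rewrite (gsign_homog _ (antipode_gr _ _ xp)) -scalerAr mulrC.
Qed.

(** Under the hypothesis the square of the antipode is a convolution inverse of the
    antipode, and so is the identity. *)
Lemma antipode_invol :
  (forall x, \cop[u, v <- x] (antipode (antipode u) * antipode v) = counit x *: 1) ->
  involutive (antipode : C -> C).
Proof.
move=> inv x.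
rewrite -(sw2_counitr (f := fun z => antipode (antipode z))); last by lin.
transitivity (\cop[u, v <- x] \cop[a, b <- v]
    (antipode (antipode u) * (antipode a * b))).
  apply: eq_sw2 => u v.
  by rewrite (sw2_antipodel (f := fun z => antipode (antipode u) * z)) ?mulr1 //; lin.
rewrite -(sw2_coassoc (F := fun u a b => antipode (antipode u) * (antipode a * b)));
  last by trilin_tac.
rewrite -[RHS](sw2_counitl (f := id)) //; apply: eq_sw2 => u v.
under eq_sw2 => a b do rewrite mulrA.
by rewrite -sw2_mull inv -scalerAl mul1r.
Qed.

Lemma antipode_invol_cocomm : cocommutative C -> involutive (antipode : C -> C).
Proof.
move=> Cc; apply: antipode_invol => x.
have [s Es] := hexp_exists (comul x).
rewrite (sw2_cocomm Cc _ Es); last by bilin_tac.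
rewrite -[X in _ *: X]antipode1 -(sw2_antipoder (f := antipode)); last by lin.
rewrite (sw2_hexp _ Es); last by bilin_tac.
apply: eq_bigr => p _.
by rewrite (antipodeM (hvalP _) (antipode_gr _ _ (hvalP _))).
Qed.

Lemma antipode_invol_comm : graded_commutative C -> involutive (antipode : C -> C).
Proof.
move=> Cc; apply: antipode_invol => x.
have [s Es] := hexp_exists (comul x).
rewrite -[X in _ *: X]antipode1 -(sw2_antipodel (f := antipode)); last by lin.
rewrite !(sw2_hexp _ Es); try by bilin_tac.
apply: eq_bigr => p _.
rewrite (antipodeM (antipode_gr _ _ (hvalP _)) (hvalP _)).
have := Cc (Homog (antipode_gr _ _ (antipode_gr _ _ (hvalP p.1))))
  (Homog (antipode_gr _ _ (hvalP p.2))).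
by move=> /= ->.
Qed.

End Antipode.

Section UngradedHopf.
Variables (K : comNzRingType) (B : gradedHopfType K).
Hypothesis B0 : ungraded B.

Lemma ungraded_sw2_mul (W : lmodType K) (F : B -> B -> W) x y : is_bilinear F ->
  sweedler2 F (x * y) =
  \cop[x1, x2 <- x] \cop[y1, y2 <- y] F (x1 * y1) (x2 * y2).
Proof.
move=> Fb; pose h (x : B) := [seq (Homog (B0 p.1), Homog (B0 p.2)) | p <- repr (comul x)].
have hE z : hexp (comul z) (h z) by rewrite /hexp big_map /= -tensor_sum_repr.
rewrite (sw2_mul Fb (hE x) (hE y)) big_map; apply: eq_bigr => p _.
by rewrite big_map; apply: eq_bigr => q _; rewrite /= ksign0 scale1r.
Qed.

Lemma ungraded_mulC : graded_commutative B -> forall x y : B, x * y = y * x.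
Proof.
move=> Bc x y; have := Bc (Homog (B0 x)) (Homog (B0 y)).
by rewrite /= ksign0 scale1r.
Qed.

Lemma ungraded_antipodeM (x y : B) : antipode (x * y) = antipode y * antipode x.
Proof. by rewrite (antipodeM (B0 x) (B0 y)) ksign0 scale1r. Qed.

(** The antipode reverses the comultiplication, by uniqueness of the convolution
    inverse of the comultiplication, tested on the bilinear functions [F]. *)
Lemma sw2_antipode (W : lmodType K) (F : B -> B -> W) x : is_bilinear F ->
  sweedler2 F (antipode x) = \cop[u, v <- x] F (antipode v) (antipode u).
Proof.
move=> Fb; have [F1 F2] := Fb.
have inv (G : B -> B -> W) X : is_bilinear G -> \cop[a, Y <- X] \cop[b, Z <- Y]
    \cop[c, d <- Z] G (a * antipode d) (b * antipode c) = counit X *: G 1 1.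
  case=> G1 G2; rewrite -(sw2_antipoder (f := fun z => G z 1)); last by lin.
  apply: eq_sw2 => a Y.
  rewrite -(sw2_coassoc (F := fun b c d => G (a * antipode d) (b * antipode c)));
    last by trilin_tac.
  rewrite -(sw2_counitl (f := fun d => G (a * antipode d) 1)); last by lin.
  apply: eq_sw2 => T d.
  by rewrite (sw2_antipoder (f := fun z => G (a * antipode d) z)); last by lin.
pose H x1 y Z := \cop[p1, p2 <- antipode x1] \cop[a, b <- y] \cop[c, d <- Z]
  F (p1 * a * antipode d) (p2 * b * antipode c).
transitivity (\cop[x1, X <- x] \cop[y, Z <- X] H x1 y Z).
  rewrite -(sw2_counitr (f := fun x => sweedler2 F (antipode x))); last by lin.
  apply: eq_sw2 => x1 X; rewrite /H sw2_exchange -sw2Z; apply: eq_sw2 => p1 p2.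
  rewrite (sw2_coassoc (F := fun a b Z => \cop[c, d <- Z]
    F (p1 * a * antipode d) (p2 * b * antipode c))); last by trilin_tac.
  rewrite -[p1 in LHS]mulr1 -[p2 in LHS]mulr1.
  rewrite -(inv (fun u v => F (p1 * u) (p2 * v))); last by bilin_tac.
  apply: eq_sw2 => a Y; apply: eq_sw2 => b Z; apply: eq_sw2 => c d.
  by rewrite !mulrA.
rewrite -sw2_coassoc; last by rewrite /H; trilin_tac.
rewrite -(sw2_counitl (f := fun Z => \cop[c, d <- Z] F (antipode d) (antipode c)));
  last by lin.
apply: eq_sw2 => X Z.
pose k u v := \cop[c, d <- Z] F (u * antipode d) (v * antipode c).
have kb : is_bilinear k by rewrite /k; bilin_tac.
transitivity (\cop[x1, y <- X] sweedler2 k (antipode x1 * y)).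
  by apply: eq_sw2 => x1 y; rewrite ungraded_sw2_mul.
rewrite (sw2_antipodel (f := fun z => sweedler2 k z)); last by lin.
rewrite sw2_1 //; congr (_ *: _); apply: eq_sw2 => c d.
by rewrite !mul1r.
Qed.

End UngradedHopf.

(** * Graded derivations *)

Section GradedDerivations.
Variables (K : comNzRingType) (R : gradedAlgType K).
Implicit Types (D E : R -> R) (d p q : int) (u v : R).

Definition graded_derivation d D : Prop :=
  is_linear D /\ forall p u v, gr p u ->
    D (u * v) = D u * v + ksign (d * p) *: (u * D v).

Lemma graded_derivation1 d D : graded_derivation d D -> D 1 = 0.
Proof.
case=> _ /(_ 0 1 1 gr_1); rewrite mulr0 ksign0 scale1r !mul1r mulr1.
by rewrite -[X in X = _]addr0 => /addrI.
Qed.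

Lemma graded_derivationD d D E : graded_derivation d D -> graded_derivation d E ->
  graded_derivation d (fun u => D u + E u).
Proof.
move=> [Dl DM] [El EM]; split=> [|p u v up]; first exact: lin_add.
by rewrite (DM _ _ _ up) (EM _ _ _ up) mulrDl mulrDr scalerDr addrACA.
Qed.

Lemma graded_derivationZ d a D : graded_derivation d D ->
  graded_derivation d (fun u => a *: D u).
Proof.
move=> [Dl DM]; split=> [|p u v up]; first exact: lin_scale.
by rewrite (DM _ _ _ up) scalerDr scalerAl -scalerAr !scalerA mulrC.
Qed.

Lemma graded_derivation_mull d q z D : graded_commutative R -> gr q z ->
  graded_derivation d D -> graded_derivation (q + d) (fun u => z * D u).
Proof.
move=> Rc zq [Dl DM]; split=> [|p u v up]; first exact: lin_mulr.
rewrite (DM _ _ _ up) mulrDr mulrA; congr (_ + _).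
rewrite -scalerAr [z * (u * _)]mulrA [u * (z * _)]mulrA.
have /= -> := Rc (Homog zq) (Homog up); rewrite -scalerAl; ksign_tac.
Qed.

End GradedDerivations.

(** * Derivations of the representation algebra *)

Section RepresentationAlgebra.
Variables (K : comNzRingType) (A B : gradedBialgType K).
Notation R := (repalg A B).

Lemma rgenM_sw2 (x y : A) (b : B) :
  rgen (x * y) b = \cop[b1, b2 <- b] (rgen x b1 * rgen y b2) :> R.
Proof. exact/rgen_mull/tensor_sum_repr. Qed.

Lemma rgen_mul_sw2 (x : A) (b c : B) :
  rgen x (b * c) = \cop[x1, x2 <- x] (rgen x1 b * rgen x2 c) :> R.
Proof. exact/rgen_mulr/tensor_sum_repr. Qed.

(** Commutation with a fixed element passes from the generators to their products;
    this is used once for each factor. *)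
Lemma repalg_comm : graded_commutative R.
Proof.
have ext r (v : R) : (forall p q x b, gr p x -> gr q b ->
    rgen x b * v = ksign ((p + q) * r) *: (v * rgen x b)) ->
    forall p u, gr p u -> u * v = ksign (p * r) *: (v * u).
  move=> vgen p u; elim=> {p u} [p|p a u w _ IHu _ IHw||p q u w _ IHu _ IHw|].
  - by rewrite mul0r mulr0 scaler0.
  - rewrite mulrDl mulrDr -scalerAl IHu IHw scalerDr !scalerA mulrC.
    by rewrite -scalerAr scalerA.
  - by rewrite mulr1 mul1r mul0r ksign0 scale1r.
  - rewrite -mulrA IHw -scalerAr [u * (v * _)]mulrA IHu -scalerAl -mulrA; ksign_tac.
  - exact: vgen.
have flip p q (u v : R) : u * v = ksign (p * q) *: (v * u) ->
    v * u = ksign (q * p) *: (u * v).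
  by move=> ->; rewrite scalerA [q * p]mulrC ksign_sqr scale1r.
move=> [u p up] [v q vq] /=; apply: (ext) up => p1 q1 x b xp bq.
apply: flip; apply: (ext) vq => p2 q2 y c yp cq.
exact: (rgen_comm (Homog yp) (Homog xp) (Homog cq) (Homog bq)).
Qed.

Lemma repalg_commE p q (u v : R) : gr p u -> gr q v ->
  u * v = ksign (p * q) *: (v * u).
Proof. by move=> up vq; apply: (repalg_comm (Homog up) (Homog vq)). Qed.

End RepresentationAlgebra.

Section DerivationsOfRepresentationAlgebra.
Variables (K : comNzRingType) (A B : gradedBialgType K).
Hypothesis B0 : ungraded B.
Notation R := (repalg A B).
Implicit Types (d p q : int) (g : A -> B -> R) (u v : R) (t : rterm A B).

Lemma ungraded_eq0 q (b : B) : gr q b -> q != 0 -> b = 0.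
Proof. by move=> bq; apply: gr_disjoint bq (B0 b). Qed.

Lemma rgen_gr p (x : A) (b : B) : gr p x -> gr p (rgen x b : R).
Proof. by move=> xp; apply: gr_eq (repalg_gr_gen xp (B0 b)) (addr0 p). Qed.

Lemma repalg_homog_ind (P : int -> R -> Prop) :
  (forall p, P p 0) ->
  (forall p a u v, gr p u -> gr p v -> P p u -> P p v -> P p (a *: u + v)) ->
  P 0 1 ->
  (forall p q u v, gr p u -> gr q v -> P p u -> P q v -> P (p + q) (u * v)) ->
  (forall p x b, gr p x -> P p (rgen x b)) ->
  forall p u, gr p u -> P p u.
Proof.
move=> P0 Pl P1 PM Pg p u; elim=> {p u} // [p a u v up|p q u v up|p q x b xp bq].
- by move=> Pu vp; apply: Pl.
- by move=> Pu vq; apply: PM.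
have [q0|q0] := eqVneq q 0; first by rewrite q0 addr0; apply: Pg.
by rewrite (ungraded_eq0 bq q0) linear0r.
Qed.

Lemma graded_derivation_ext d D E :
  graded_derivation d D -> graded_derivation d E ->
  (forall x b, D (rgen x b) = E (rgen x b)) -> D =1 E :> (R -> R).
Proof.
move=> dD dE DE; have [Dl DM] := dD; have [El EM] := dE.
apply: homog_eq => //; apply: repalg_homog_ind => [p|p a u v _ _ Eu Ev||
  p q u v up vq Eu Ev|p x b _] //.
- by rewrite !linear_fun0.
- by rewrite Dl El Eu Ev.
- by rewrite (graded_derivation1 dD) (graded_derivation1 dE).
- by rewrite (DM _ _ _ up) (EM _ _ _ up) Eu Ev.
Qed.

(** The values on the generators of a derivation of degree [d]: the last two
    conditions are the Leibniz rule applied to the relations that expand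
    (xy)_b and x_(bc). *)
Definition derivation_data d g : Prop :=
  [/\ is_bilinear g, forall p x b, gr p x -> gr (p + d) (g x b),
      forall x y b, g (x * y) b =
        \cop[b1, b2 <- b] (g x b1 * rgen y b2 + gsign d (rgen x b1) * g y b2)
    & forall x b c, g x (b * c) =
        \cop[x1, x2 <- x] (g x1 b * rgen x2 c + gsign d (rgen x1 b) * g x2 c)].

Lemma derivation_data0 d : derivation_data d (fun _ _ => 0).
Proof.
split=> [|p x b _|x y b|x b c].
- by split=> ?; apply: lin_0.
- exact: gr_0.
- by rewrite /sweedler2 /tlift big1 // => p _; rewrite mul0r mulr0 addr0.
- by rewrite /sweedler2 /tlift big1 // => p _; rewrite mul0r mulr0 addr0.
Qed.

Lemma derivation_dataP d a g h : derivation_data d g -> derivation_data d h ->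
  derivation_data d (fun x b => a *: g x b + h x b).
Proof.
move=> [[g1 g2] ggr gl gr] [[h1 h2] hgr hl hr]; split=> [|p x b xp|x y b|x b c].
- by bilin_tac.
- by apply: gr_linear; [apply: ggr|apply: hgr].
- rewrite gl hl -sw2Z -sw2Dl; apply: eq_sw2 => b1 b2.
  by rewrite mulrDl mulrDr -scalerAl -scalerAr scalerDr addrACA.
- rewrite gr hr -sw2Z -sw2Dl; apply: eq_sw2 => x1 x2.
  by rewrite mulrDl mulrDr -scalerAl -scalerAr scalerDr addrACA.
Qed.

Lemma derivation_data_mull d q u g : gr q u -> derivation_data d g ->
  derivation_data (q + d) (fun x b => u * g x b).
Proof.
move=> uq [[g1 g2] ggr gl gr]; split=> [|p x b xp|x y b|x b c].
- by bilin_tac.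
- by apply: gr_eq (gr_M _ _ _ _ uq (ggr _ _ b xp)) _; rewrite addrCA.
- rewrite gl sw2_mulr; apply: eq_sw2 => b1 b2.
  by rewrite mulrDr !mulrA (gsign_comm _ _ (@repalg_comm _ _ _) uq).
- rewrite gr sw2_mulr; apply: eq_sw2 => x1 x2.
  by rewrite mulrDr !mulrA (gsign_comm _ _ (@repalg_comm _ _ _) uq).
Qed.

(** The recursion takes place on formal expressions, where no relation has to be
    respected; [req_der] then makes it descend to the quotient. *)
Fixpoint rterm_der d g (t : rterm A B) : R :=
  match t with
  | RGen x b => g x b
  | RZero => 0
  | ROne => 0
  | RAdd t u => rterm_der d g t + rterm_der d g u
  | RMul t u =>
      rterm_der d g t * rclass u + gsign d (rclass t) * rterm_der d g u
  | RScale a t => a *: rterm_der d g t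
  end.

Lemma rterm_der_sum d g s :
  rterm_der d g (rsum s) = \sum_(t <- s) rterm_der d g t.
Proof. by elim: s => [|t s IH] /=; rewrite ?big_nil // big_cons IH. Qed.

Lemma rterm_der_linear d a g h t :
  rterm_der d (fun x b => a *: g x b + h x b) t =
  a *: rterm_der d g t + rterm_der d h t.
Proof.
elim: t => [x b|||t IHt u IHu|t IHt u IHu|c t IHt] //=;
  rewrite ?scaler0 ?addr0 // ?IHt ?IHu.
- by rewrite scalerDr addrACA.
- by rewrite mulrDl mulrDr -scalerAl -scalerAr scalerDr addrACA.
- by rewrite scalerDr !scalerA mulrC.
Qed.

Section WellDefined.
Variables (d : int) (g : A -> B -> R).
Hypothesis g_data : derivation_data d g.

Let g_bil : is_bilinear g. Proof. by case: g_data. Qed.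

(** The Leibniz rule for 1 * 1 gives g 1 b = g 1 b + g 1 b. *)
Lemma derivation_data_1l b : g 1 b = 0.
Proof.
have [[g1 g2] _ gl _] := g_data; have := gl 1 1 b; rewrite mulr1.
under eq_sw2 => b1 b2 do rewrite !rgen_1l (linear_funZ _ _ (gsign_linear d)) gsign1
  -scalerAr -scalerAl mulr1 mul1r.
rewrite sw2Dl (sw2_counitl (f := g 1)) // (sw2_counitr (f := g 1)) //.
by rewrite -[X in X = _]addr0 => /addrI.
Qed.

Lemma derivation_data_1r x : g x 1 = 0.
Proof.
have [[g1 g2] _ _ gr] := g_data; have := gr x 1 1; rewrite mulr1.
under eq_sw2 => x1 x2 do rewrite !rgen_1r (linear_funZ _ _ (gsign_linear d)) gsign1
  -scalerAr -scalerAl mulr1 mul1r.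
rewrite sw2Dl (sw2_counitl (f := g^~ 1)) // (sw2_counitr (f := g^~ 1)) //.
by rewrite -[X in X = _]addr0 => /addrI.
Qed.

Lemma derivation_data_comm (x y : homog A) (b c : homog B) :
  g (hval x) (hval b) * rgen (hval y) (hval c) +
    gsign d (rgen (hval x) (hval b)) * g (hval y) (hval c) =
  ksign (('|x| + '|b|) * ('|y| + '|c|)) *:
    (g (hval y) (hval c) * rgen (hval x) (hval b) +
     gsign d (rgen (hval y) (hval c)) * g (hval x) (hval b)).
Proof.
have [[g1 g2] ggr _ _] := g_data.
have gxb (z : homog A) (e : homog B) : gr ('|z| + '|e| + d) (g (hval z) (hval e)).
  have [q0|q0] := eqVneq ('|e|) 0.
    by rewrite q0 addr0; apply/ggr/hvalP.
  by rewrite (ungraded_eq0 (hvalP e) q0) linear_fun0 //; apply: gr_0.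
have rxb (z : homog A) (e : homog B) :
    gr ('|z| + '|e|) (rgen (hval z) (hval e) : R).
  exact: repalg_gr_gen (hvalP z) (hvalP e).
move: (gxb x b) (gxb y c) (rxb x b) (rxb y c).
move: ('|x| + '|b|) ('|y| + '|c|) (g (hval x) _) (g (hval y) _) => p q gx gy.
move=> gxp gyq xp yq.
rewrite !(gsign_homog _ xp, gsign_homog _ yq) (repalg_commE gxp yq).
rewrite (repalg_commE gyq xp) -!scalerAl scalerDr !scalerA addrC.
by congr (_ + _); ksign_tac.
Qed.

Lemma req_der (t u : rterm A B) : req t u -> rterm_der d g t = rterm_der d g u.
Proof.
have [[g1 g2] _ gl gr] := g_data.
have gsl := @gsign_linear _ (repalg A B) d.
elim=> {t u} //=.
- by move=> t u v _ -> _ ->.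
- by move=> t t' u u' _ -> _ ->.
- by move=> t t' u u' /rclassP -> -> /rclassP -> ->.
- by move=> a t t' _ ->.
- by move=> t u v; rewrite addrA.
- by move=> t u; rewrite addrC.
- by move=> t; rewrite add0r.
- by move=> t; rewrite scaleN1r addNr.
- move=> t u v; rewrite !rclassM gsignM mulrDl mulrDr !mulrA addrA.
  by [].
- by move=> t; rewrite mul0r gsign1 mul1r add0r.
- by move=> t; rewrite mulr0 addr0 mulr1.
- by move=> t u v; rewrite rclassD linear_funD // !mulrDl addrACA.
- by move=> t u v; rewrite rclassD !mulrDr addrACA.
- by move=> a b t; rewrite scalerA.
- by move=> t; rewrite scale1r.
- by move=> a t u; rewrite scalerDr.
- by move=> a b t; rewrite scalerDl.
- by move=> a t u; rewrite rclassZ linear_funZ // scalerDr !scalerAl.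
- by move=> a t u; rewrite rclassZ -!scalerAr scalerDr.
- by move=> a x y b; apply: g1.
- by move=> a x b c; apply: g2.
- by move=> x y b s Eb; rewrite gl (sw2E _ Eb) ?rterm_der_sum ?big_map; last by bilin_tac.
- by move=> b; rewrite derivation_data_1l scaler0.
- by move=> x b c s Ex; rewrite gr (sw2E _ Ex) ?rterm_der_sum ?big_map; last by bilin_tac.
- by move=> x; rewrite derivation_data_1r scaler0.
- by move=> x y b c; rewrite -derivation_data_comm.
Qed.

End WellDefined.

Definition der_of d g (u : R) : R := rterm_der d g (repr u).

Lemma der_of_linear_data d a g h u :
  der_of d (fun x b => a *: g x b + h x b) u = a *: der_of d g u + der_of d h u.
Proof. exact: rterm_der_linear. Qed.

Section DerOf.
Variables (d : int) (g : A -> B -> R).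
Hypothesis g_data : derivation_data d g.

Lemma der_of_rclass t : der_of d g (rclass t) = rterm_der d g t.
Proof. exact/req_der/req_repr. Qed.

Lemma der_of_rgen x b : der_of d g (rgen x b) = g x b.
Proof. exact: der_of_rclass. Qed.

Lemma der_of_derivation : graded_derivation d (der_of d g).
Proof.
split=> [a u v|p u v up].
  elim/rclassW: u => t; elim/rclassW: v => u.
  by rewrite -rclassZ -rclassD !der_of_rclass.
rewrite scalerAl -(gsign_homog _ up).
elim/rclassW: u {up} => t; elim/rclassW: v => u.
by rewrite -rclassM !der_of_rclass.
Qed.

Lemma der_of_gr p u : gr p u -> gr (p + d) (der_of d g u).
Proof.
have [Dl DM] := der_of_derivation; have [_ ggr _ _] := g_data.
move: p u; apply: repalg_homog_ind => [p|p a u v _ _ Du Dv||p q u v up vq Du Dv|p x b xp].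
- by rewrite linear_fun0 //; apply: gr_0.
- by rewrite Dl; apply: gr_linear.
- by rewrite (graded_derivation1 der_of_derivation); apply: gr_0.
- rewrite (DM _ _ _ up); apply: grD; last apply: grZ.
    by apply: gr_eq (gr_M _ _ _ _ Du vq) _; ring.
  by apply: gr_eq (gr_M _ _ _ _ up Dv) _; ring.
- by rewrite der_of_rgen; apply: ggr.
Qed.

End DerOf.

End DerivationsOfRepresentationAlgebra.

(** * The coadjoint pairing *)

Section RepresentationAntipode.
Variables (K : comNzRingType) (A B : gradedHopfType K).
Notation R := (repalg A B).

(** As functions of x and b, both sides are convolution inverse to x_b: the left side
    by the relation for (xy)_b and the right side by the one for x_(bc). *)
Lemma rgen_antipode (x : A) (b : B) :
  rgen (antipode x) b = rgen x (antipode b) :> R.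
Proof.
transitivity (\cop[X, x3 <- x] \cop[x1, x2 <- X] \cop[b', b3 <- b]
  \cop[b1, b2 <- b'] (rgen x1 (antipode b1) * rgen x2 b2 * rgen (antipode x3) b3) : R).
  rewrite -(sw2_counitl (f := fun x => rgen (antipode x) b : R)); last by lin.
  apply: eq_sw2 => X x3; rewrite sw2_exchange.
  rewrite -(sw2_counitl (f := fun b => rgen (antipode x3) b : R)); last by lin.
  rewrite -sw2Z; apply: eq_sw2 => b' b3; rewrite sw2_exchange.
  under eq_sw2 => b1 b2 do rewrite -sw2_mull -rgen_mul_sw2.
  rewrite (sw2_antipodel (f := fun w => rgen X w * rgen (antipode x3) b3 : R));
    last by lin.
  by rewrite rgen_1r -scalerAl mul1r !scalerA mulrC.
rewrite (sw2_coassoc (F := fun x1 x2 x3 => \cop[b', b3 <- b] \cop[b1, b2 <- b']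
  (rgen x1 (antipode b1) * rgen x2 b2 * rgen (antipode x3) b3) : R));
  last by trilin_tac.
rewrite -[RHS](sw2_counitr (f := fun x => rgen x (antipode b) : R)); last by lin.
apply: eq_sw2 => x1 X.
under eq_sw2 => x2 x3.
  rewrite (sw2_coassoc (F := fun b1 b2 b3 => rgen x1 (antipode b1) * rgen x2 b2 *
    rgen (antipode x3) b3 : R)); last by trilin_tac.
  over.
rewrite sw2_exchange.
rewrite -(sw2_counitr (f := fun b => rgen x1 (antipode b) : R)); last by lin.
rewrite -sw2Z; apply: eq_sw2 => b1 b'.
under eq_sw2 => x2 x3.
  under eq_sw2 => b2 b3 do rewrite -mulrA.
  rewrite -sw2_mulr -rgenM_sw2; over.
rewrite (sw2_antipoder (f := fun w => rgen x1 (antipode b1) * rgen w b' : R));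
  last by lin.
by rewrite rgen_1l -scalerAr mulr1.
Qed.

End RepresentationAntipode.

Section CoadjointPairing.
Variables (K : comNzRingType) (A B : gradedHopfType K).
Variable bul : {bilinear B -> B -> K | *%R & *%R}.
Hypotheses (B0 : ungraded B) (Bc : graded_commutative B).
Hypotheses (bul_bider : biderivation bul) (bul_bal : balanced bul).
Notation R := (repalg A B).
Implicit Types (r x y z : A) (b c d : B).

Let BC : forall b c : B, b * c = c * b := ungraded_mulC B0 Bc.

(** The form contracted with the middle factor of the coadjoint coaction, which sends
    b to the tensor of b'' and s(b''') b'. *)
Definition coad r b c : R :=
  \cop[b1, d <- b] \cop[b2, b3 <- d] (bul c b2 *: rgen r (antipode b3 * b1)).

Lemma coad_trilinear : is_trilinear coad.
Proof. by rewrite /coad; split=> [b c|r c|r b]; lin. Qed.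

Lemma coad_balanced r b c : coad r b c =
  \cop[c1, d <- c] \cop[c2, c3 <- d] (bul b c2 *: rgen r (antipode c1 * c3)).
Proof.
have rl : is_linear (rgen r : B -> R) by lin.
have := congr1 (fun w : B => rgen r w : R) (bul_bal b c).
rewrite /sweedler3 !(sw2_linear _ _ rl) => E.
transitivity (\cop[b1, d <- b]
    (rgen r (\cop[b2, b3 <- d] (bul c b2 *: (antipode b3 * b1))) : R)).
  apply: eq_sw2 => b1 d; rewrite (sw2_linear _ _ rl).
  by apply: eq_sw2 => b2 b3; rewrite linear_funZ.
rewrite -E; apply: eq_sw2 => c1 d; rewrite (sw2_linear _ _ rl).
by apply: eq_sw2 => c2 c3; rewrite linear_funZ.
Qed.

Lemma coad_gr p r b c : gr p r -> gr p (coad r b c).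
Proof.
by move=> rp; apply: gr_sum => u _; apply: gr_sum => v _; apply/grZ/rgen_gr.
Qed.

Lemma coadM r b c d :
  coad r b (c * d) = counit c *: coad r b d + counit d *: coad r b c.
Proof.
rewrite -!sw2Z -sw2Dl; apply: eq_sw2 => b1 w; rewrite -!sw2Z -sw2Dl.
apply: eq_sw2 => b2 b3.
by rewrite !scalerA -scalerDl; congr (_ *: _); case: bul_bider.
Qed.

(** Both sides are expanded over c; they agree because s(r)_b = r_(s(b)) and the
    antipode of [B] is an involution. *)
Lemma coad_antipode r b c : coad (antipode r) c b = coad r b c.
Proof.
rewrite coad_balanced; apply: eq_sw2 => c1 d; apply: eq_sw2 => c2 c3.
rewrite rgen_antipode (ungraded_antipodeM B0) (antipode_invol_comm Bc).
by [].
Qed.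

Lemma rgenM_antipode x y (u v : B) : rgen (x * y) (antipode u * v) =
  \cop[u1, u2 <- u] \cop[v1, v2 <- v]
    (rgen x (antipode u2 * v1) * rgen y (antipode u1 * v2)) :> R.
Proof.
rewrite rgenM_sw2 (ungraded_sw2_mul B0); last by bilin_tac.
by rewrite (sw2_antipode B0); last by bilin_tac.
Qed.

Lemma rgenM_antipode_absorb x y (u v e : B) :
  \cop[y1, y2 <- y] (rgen (x * y1) (antipode u * v) * rgen y2 e : R) =
  \cop[u1, u2 <- u] \cop[v1, v2 <- v]
    (rgen x (antipode u2 * v1) * rgen y (antipode u1 * v2 * e)).
Proof.
under eq_sw2 => y1 y2 do rewrite rgenM_antipode sw2_mull.
rewrite sw2_exchange; apply: eq_sw2 => u1 u2.
under eq_sw2 => y1 y2 do rewrite sw2_mull.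
rewrite sw2_exchange; apply: eq_sw2 => v1 v2.
under eq_sw2 => y1 y2 do rewrite -mulrA.
by rewrite -sw2_mulr -rgen_mul_sw2.
Qed.

(** Write c1, c2, ... for the factors of an iterated coproduct of c.  Expanded over c,
    the left side contains z'_(s(c2) c6) and z''_(c1), which combine to
    z_(c1 s(c2) c6) by commutativity of [B]; then c1 s(c2) is contracted. *)
Lemma coad_absorbr r z b c :
  \cop[z1, z2 <- z] \cop[c1, c2 <- c] (coad (r * z1) b c2 * rgen z2 c1) =
  \cop[c1, c2 <- c] (coad r b c1 * rgen z c2).
Proof.
pose G a u e w : R := \cop[d2, d3 <- w] \cop[v1, v2 <- d3] (bul b d2 *:
  (rgen r (antipode e * v1) * rgen z (a * antipode u * v2))).
transitivity (\cop[c1, d <- c] \cop[d1, w <- d] \cop[u, e <- d1] G c1 u e w).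
  rewrite sw2_exchange; apply: eq_sw2 => c1 d.
  under eq_sw2 => z1 z2 do rewrite coad_balanced sw2_mull.
  rewrite sw2_exchange; apply: eq_sw2 => d1 w.
  under eq_sw2 => z1 z2 do rewrite sw2_mull.
  rewrite /G [RHS]sw2_exchange [LHS]sw2_exchange; apply: eq_sw2 => d2 d3.
  under eq_sw2 => z1 z2 do rewrite -scalerAl.
  rewrite sw2Z rgenM_antipode_absorb -sw2Z; apply: eq_sw2 => u e.
  rewrite -sw2Z; apply: eq_sw2 => v1 v2.
  by rewrite [_ * c1]BC mulrA.
transitivity (\cop[g, w <- c] \cop[c1, u <- g] \cop[e, w' <- w] G c1 u e w').
  rewrite (sw2_coassoc (F := fun c1 u w => \cop[e, w' <- w] G c1 u e w')); last first.
    by rewrite /G; trilin_tac.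
  apply: eq_sw2 => c1 d.
  by rewrite (sw2_coassoc (F := fun u e w => G c1 u e w)) //; rewrite /G; trilin_tac.
transitivity (\cop[e, w <- c] \cop[d2, d3 <- w] \cop[v1, v2 <- d3] (bul b d2 *:
    (rgen r (antipode e * v1) * rgen z v2)) : R).
  rewrite -[RHS](sw2_counitl (f := fun c => \cop[e, w <- c] \cop[d2, d3 <- w]
    \cop[v1, v2 <- d3] (bul b d2 *: (rgen r (antipode e * v1) * rgen z v2)) : R));
    last by lin.
  apply: eq_sw2 => g w.
  rewrite (sw2_antipoder (f := fun a => \cop[e, w' <- w] \cop[d2, d3 <- w']
    \cop[v1, v2 <- d3] (bul b d2 *:
      (rgen r (antipode e * v1) * rgen z (a * v2))) : R)); last by lin.
  congr (_ *: _); apply: eq_sw2 => e w'; apply: eq_sw2 => d2 d3.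
  by apply: eq_sw2 => v1 v2; rewrite mul1r.
transitivity (\cop[m, t <- c] \cop[e, m' <- m] \cop[d2, v1 <- m'] (bul b d2 *:
    (rgen r (antipode e * v1) * rgen z t)) : R).
  rewrite (sw2_coassoc (F := fun e m' t => \cop[d2, v1 <- m'] (bul b d2 *:
    (rgen r (antipode e * v1) * rgen z t)) : R)); last by trilin_tac.
  apply: eq_sw2 => e w.
  rewrite (sw2_coassoc (F := fun d2 v1 t => bul b d2 *:
    (rgen r (antipode e * v1) * rgen z t) : R)) //; trilin_tac.
apply: eq_sw2 => m t; rewrite coad_balanced sw2_mull; apply: eq_sw2 => e m'.
by rewrite sw2_mull; apply: eq_sw2 => d2 v1; rewrite scalerAl.
Qed.

(** The mirror image, with coad expanded over b. *)
Lemma coad_absorbl r y b c :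
  \cop[y1, y2 <- y] \cop[b1, b2 <- b] (rgen y1 b2 * coad (y2 * r) b1 c) =
  \cop[b1, b2 <- b] (rgen y b1 * coad r b2 c).
Proof.
pose H d1 d2 u1 a : R := \cop[v1, v2 <- d1] (bul c d2 *:
  (rgen y (a * v1) * rgen r (antipode u1 * v2))).
transitivity (\cop[d, b2 <- b] \cop[d1, w <- d] \cop[d2, d3 <- w]
    \cop[u1, u2 <- d3] H d1 d2 u1 (antipode u2 * b2)).
  rewrite sw2_exchange; apply: eq_sw2 => d b2.
  under eq_sw2 => y1 y2 do rewrite sw2_mulr.
  rewrite sw2_exchange; apply: eq_sw2 => d1 w.
  under eq_sw2 => y1 y2 do rewrite sw2_mulr.
  rewrite sw2_exchange; apply: eq_sw2 => d2 d3.
  under eq_sw2 => y1 y2.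
    rewrite rgenM_antipode -sw2Z sw2_mulr.
    under eq_sw2 => u1 u2 do rewrite -sw2Z sw2_mulr.
    over.
  rewrite sw2_exchange; apply: eq_sw2 => u1 u2.
  rewrite sw2_exchange; apply: eq_sw2 => v1 v2.
  under eq_sw2 => y1 y2 do rewrite -scalerAr mulrA.
  by rewrite sw2Z -sw2_mull -rgen_mul_sw2 mulrA [b2 * _]BC.
transitivity (\cop[d1, W <- b] \cop[d2, u <- W] H d1 d2 u 1).
  rewrite (sw2_coassoc (F := fun d1 w b2 => \cop[d2, d3 <- w]
    \cop[u1, u2 <- d3] H d1 d2 u1 (antipode u2 * b2))); last by rewrite /H; trilin_tac.
  apply: eq_sw2 => d1 W.
  rewrite (sw2_coassoc (F := fun d2 d3 b2 =>
    \cop[u1, u2 <- d3] H d1 d2 u1 (antipode u2 * b2))); last by rewrite /H; trilin_tac.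
  apply: eq_sw2 => d2 w.
  rewrite (sw2_coassoc (F := fun u1 u2 b2 => H d1 d2 u1 (antipode u2 * b2)));
    last by rewrite /H; trilin_tac.
  rewrite -(sw2_counitr (f := fun u => H d1 d2 u 1)); last by rewrite /H; lin.
  apply: eq_sw2 => u1 w'.
  by rewrite (sw2_antipodel (f := fun a => H d1 d2 u1 a)) //; rewrite /H; lin.
transitivity (\cop[d1, W <- b] \cop[v1, v2 <- d1] \cop[d2, u <- W] (bul c d2 *:
    (rgen y v1 * rgen r (antipode u * v2))) : R).
  apply: eq_sw2 => d1 W; rewrite [RHS]sw2_exchange; apply: eq_sw2 => d2 u.
  by apply: eq_sw2 => v1 v2; rewrite mul1r.
rewrite (sw2_coassoc (F := fun v1 v2 W => \cop[d2, u <- W] (bul c d2 *: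
    (rgen y v1 * rgen r (antipode u * v2))) : R)); last by trilin_tac.
apply: eq_sw2 => v1 b2; rewrite sw2_mulr; apply: eq_sw2 => v2 W.
by rewrite sw2_mulr; apply: eq_sw2 => d2 u; rewrite scalerAr.
Qed.

(** Insert s(z') z'' next to r on the right side, then absorb z''. *)
Lemma coad_absorbr_antipode r z b c :
  \cop[z1, z2 <- z] \cop[c1, c2 <- c] (coad (r * antipode z1) b c1 * rgen z2 c2) =
  \cop[c1, c2 <- c] (coad r b c2 * rgen z c1).
Proof.
have [m1 m2 m3] := coad_trilinear.
transitivity (\cop[z1, W <- z] \cop[z2, z3 <- W] \cop[c1, c2 <- c]
    (coad (r * antipode z1 * z2) b c2 * rgen z3 c1)).
  by apply: eq_sw2 => z1 W; rewrite coad_absorbr.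
rewrite -(sw2_coassoc (F := fun z1 z2 z3 => \cop[c1, c2 <- c]
    (coad (r * antipode z1 * z2) b c2 * rgen z3 c1))); last by trilin_tac.
rewrite -(sw2_counitl (f := fun z => \cop[c1, c2 <- c] (coad r b c2 * rgen z c1)));
  last by lin.
apply: eq_sw2 => Z z3.
under eq_sw2 => z1 z2.
  under eq_sw2 => c1 c2 do rewrite -mulrA.
  over.
rewrite (sw2_antipodel (f := fun w => \cop[c1, c2 <- c]
  (coad (r * w) b c2 * rgen z3 c1))); last by lin.
by rewrite mulr1.
Qed.

Lemma coad_absorbl_antipode r y b c :
  \cop[y1, y2 <- y] \cop[b1, b2 <- b] (rgen y1 b1 * coad (antipode y2 * r) b2 c) =
  \cop[b1, b2 <- b] (rgen y b2 * coad r b1 c).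
Proof.
have [m1 m2 m3] := coad_trilinear.
transitivity (\cop[W, y3 <- y] \cop[y1, y2 <- W] \cop[b1, b2 <- b]
    (rgen y1 b2 * coad (y2 * (antipode y3 * r)) b1 c)).
  by apply: eq_sw2 => W y3; rewrite coad_absorbl.
rewrite (sw2_coassoc (F := fun y1 y2 y3 => \cop[b1, b2 <- b]
    (rgen y1 b2 * coad (y2 * (antipode y3 * r)) b1 c))); last by trilin_tac.
rewrite -(sw2_counitr (f := fun y => \cop[b1, b2 <- b] (rgen y b2 * coad r b1 c)));
  last by lin.
apply: eq_sw2 => y1 Y.
under eq_sw2 => y2 y3.
  under eq_sw2 => b1 b2 do rewrite mulrA.
  over.
rewrite (sw2_antipoder (f := fun w => \cop[b1, b2 <- b]
  (rgen y1 b2 * coad (w * r) b1 c))); last by lin.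
by rewrite mul1r.
Qed.

End CoadjointPairing.

(** * The bracket of two generators *)

Section FoxPairingAntipode.
Variables (K : comNzRingType) (A : gradedHopfType K) (n : int).
Variable rho : {bilinear A -> A -> A}.
Hypothesis rho_fox : fox_pairing n rho.
Implicit Types x y z : A.

Lemma fox_pairing1l z : rho 1 z = 0.
Proof.
have [_ _ rM] := rho_fox; have := rM 1 1 z.
by rewrite mulr1 rmorph1 scale1r mul1r -[X in X = _]addr0 => /addrI.
Qed.

Lemma fox_pairing1r z : rho z 1 = 0.
Proof.
have [_ rM _] := rho_fox; have := rM z 1 1.
by rewrite mulr1 rmorph1 scale1r mulr1 -[X in X = _]addr0 => /addrI.
Qed.

(** Apply rho(-, z) to s(x') x'' = counit(x). *)
Lemma fox_pairing_antipodel x z :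
  rho (antipode x) z = - \cop[x1, x2 <- x] (antipode x1 * rho x2 z).
Proof.
have [_ _ rM] := rho_fox; apply/eqP; rewrite -addr_eq0; apply/eqP.
have := sw2_antipodel (f := fun w => rho w z) x; rewrite fox_pairing1l scaler0.
move=> <-; last by lin.
under [RHS]eq_sw2 => x1 x2 do rewrite rM.
by rewrite sw2Dl (sw2_counitr (f := fun x => rho (antipode x) z)) //; lin.
Qed.

Lemma fox_pairing_antipoder x z :
  rho z (antipode x) = - \cop[x1, x2 <- x] (rho z x1 * antipode x2).
Proof.
have [_ rM _] := rho_fox; apply/eqP; rewrite -addr_eq0; apply/eqP.
have := sw2_antipoder (f := fun w => rho z w) x; rewrite fox_pairing1r scaler0.
move=> <-; last by lin.
under [RHS]eq_sw2 => x1 x2 do rewrite rM.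
by rewrite sw2Dl (sw2_counitl (f := fun x => rho z (antipode x))) 1?addrC //; lin.
Qed.

Lemma antipode_invE x : involutive (antipode : A -> A) ->
  antipode (antipode_inv x) = x.
Proof.
move=> sK; rewrite /antipode_inv; case: xgetP => [y _ //|/(_ (antipode x))].
by rewrite /= sK.
Qed.

Lemma fox_antisymmetric_antipode p q x y : cocommutative A ->
  fox_antisymmetric n rho -> gr p x -> gr q y ->
  antipode (rho y x) =
    - (ksign ((p + n) * (q + n)) *: rho (antipode x) (antipode y)).
Proof.
move=> Ac anti xp yq; have := anti (Homog yq) (Homog xp); rewrite /fox_transpose /=.
move/(congr1 antipode); rewrite linearN linearZ /= => E.
rewrite -[LHS]opprK -{}E antipode_invE; last exact: antipode_invol_cocomm.
by rewrite [(q + n) * _]mulrC.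
Qed.

End FoxPairingAntipode.

Section FoxBracketOnGenerators.
Variables (K : comNzRingType) (A B : gradedHopfType K) (n : int).
Variables (rho : {bilinear A -> A -> A}) (bul : {bilinear B -> B -> K | *%R & *%R}).
Hypotheses (Ac : cocommutative A) (rho_fox : fox_pairing n rho).
Hypothesis rho_anti : fox_antisymmetric n rho.
Hypotheses (B0 : ungraded B) (Bc : graded_commutative B).
Hypotheses (bul_bider : biderivation bul) (bul_bal : balanced bul).
Notation R := (repalg A B).
Notation coad := (@coad K A B bul).
Implicit Types (x y z : A) (b c e : B).

(** The part of [fox_gen] that does not involve y''. *)
Definition fox_half x b y e : R :=
  \cop[x1, x2 <- x] \cop[b1, b2 <- b] (rgen x1 b2 * coad (rho x2 y) b1 e).

(** The value of {x_b, y_c} in a form free of signs. *)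
Definition fox_gen x b y c : R :=
  \cop[y1, y2 <- y] \cop[c1, c2 <- c] (fox_half x b y1 c2 * rgen y2 c1).

Lemma fox_genE x b y c : fox_gen x b y c =
  \cop[x1, x2 <- x] \cop[y1, y2 <- y] \cop[b1, b2 <- b] \cop[c1, c2 <- c]
    (rgen x1 b2 * coad (rho x2 y1) b1 c2 * rgen y2 c1).
Proof.
rewrite [RHS]sw2_exchange; apply: eq_sw2 => y1 y2.
under [RHS]eq_sw2 => x1 x2 do rewrite sw2_exchange.
rewrite [RHS]sw2_exchange; apply: eq_sw2 => c1 c2.
by rewrite sw2_mull; apply: eq_sw2 => x1 x2; rewrite sw2_mull.
Qed.

Lemma fox_gen_linear1 b y c : is_linear (fun x => fox_gen x b y c).
Proof.
have [m1 m2 m3] := @coad_trilinear K A B bul.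
move=> a u v; rewrite !fox_genE; move: a u v; change (is_linear (fun x =>
  \cop[x1, x2 <- x] \cop[y1, y2 <- y] \cop[b1, b2 <- b] \cop[c1, c2 <- c]
    (rgen x1 b2 * coad (rho x2 y1) b1 c2 * rgen y2 c1) : R)).
by lin.
Qed.

Section FixedLeftGenerator.
Variables (p : int) (x : A) (b : B).
Hypothesis xp : gr p x.

Let m_lin := @coad_trilinear K A B bul.

Lemma fox_half_bilinear : is_bilinear (fox_half x b).
Proof. by have [m1 m2 m3] := m_lin; rewrite /fox_half; bilin_tac. Qed.

Lemma fox_half_gr q y e : gr q y -> gr (q + (p + n)) (fox_half x b y e).
Proof.
have [m1 m2 m3] := m_lin; have [rgr _ _] := rho_fox.
move=> yq; apply: (gr_sw2 _ xp); first by bilin_tac.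
move=> r s u v ur vs rs; apply: gr_sum => i _.
apply: gr_eq (gr_M _ _ _ _ (rgen_gr B0 _ ur) (coad_gr bul B0 _ _ (rgr _ _ _ _ vs yq))) _.
by rewrite -rs; ring.
Qed.

Lemma fox_halfM y c e :
  fox_half x b y (c * e) = counit c *: fox_half x b y e + counit e *: fox_half x b y c.
Proof.
rewrite -!sw2Z -sw2Dl; apply: eq_sw2 => x1 x2; rewrite -!sw2Z -sw2Dl.
apply: eq_sw2 => b1 b2.
by rewrite (coadM bul_bider) mulrDr -!scalerAr.
Qed.

(** The sign of the exchange of y' and y'' given by cocommutativity is part of the
    sign of the exchange of the two factors in the representation algebra. *)
Lemma fox_half_comm y c e :
  \cop[y1, y2 <- y] (fox_half x b y1 e * rgen y2 c) =
  \cop[y1, y2 <- y] (gsign (p + n) (rgen y1 c : R) * fox_half x b y2 e).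
Proof.
have [f1 f2] := fox_half_bilinear; have [s Es] := hexp_exists (comul y).
have gl := @gsign_linear _ R (p + n).
rewrite (sw2_cocomm Ac _ Es); last by bilin_tac.
rewrite (sw2_hexp _ Es); last by bilin_tac.
apply: eq_bigr => h _.
have h1 := rgen_gr B0 c (hvalP h.1); have h2 := fox_half_gr e (hvalP h.2).
rewrite (gsign_homog _ h1) -scalerAl (repalg_commE h2 h1); ksign_tac.
Qed.

(** The coproduct of [ce] splits into two sums since coad is a derivation in it.  One
    sum has the shape of the first term; in the other, y''_c has to move to the
    left through the first factor ([fox_half_comm]). *)
Lemma fox_gen_mulr y c e : fox_gen x b y (c * e) =
  \cop[y1, y2 <- y]
    (fox_gen x b y1 c * rgen y2 e + gsign (p + n) (rgen y1 c) * fox_gen x b y2 e).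
Proof.
have [f1 f2] := fox_half_bilinear; have gl := @gsign_linear _ R (p + n).
transitivity (\cop[y1, Y <- y] \cop[y2, y3 <- Y]
   (\cop[c1, c2 <- c] (fox_half x b y1 c2 * rgen y2 c1 * rgen y3 e) +
    \cop[e1, e2 <- e] (fox_half x b y1 e2 * rgen y2 c * rgen y3 e1))).
  apply: eq_sw2 => y1 Y; rewrite (ungraded_sw2_mul B0); last by bilin_tac.
  transitivity (\cop[c1, c2 <- c] \cop[e1, e2 <- e]
     (counit e2 *: (fox_half x b y1 c2 * rgen Y (c1 * e1))) +
     \cop[c1, c2 <- c] \cop[e1, e2 <- e]
     (counit c2 *: (fox_half x b y1 e2 * rgen Y (c1 * e1)))).
    rewrite -sw2Dl; apply: eq_sw2 => c1 c2; rewrite -sw2Dl; apply: eq_sw2 => e1 e2.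
    by rewrite fox_halfM mulrDl addrC -!scalerAl.
  rewrite sw2Dl; congr (_ + _).
    rewrite [RHS]sw2_exchange; apply: eq_sw2 => c1 c2.
    rewrite (sw2_counitr (f := fun e => fox_half x b y1 c2 * rgen Y (c1 * e)));
      last by lin.
    by rewrite rgen_mul_sw2 sw2_mulr; apply: eq_sw2 => y2 y3; rewrite mulrA.
  rewrite sw2_exchange [RHS]sw2_exchange; apply: eq_sw2 => e1 e2.
  rewrite (sw2_counitr (f := fun c => fox_half x b y1 e2 * rgen Y (c * e1)));
    last by lin.
  by rewrite rgen_mul_sw2 sw2_mulr; apply: eq_sw2 => y2 y3; rewrite mulrA.
under eq_sw2 => y1 Y do rewrite sw2Dl.
rewrite !sw2Dl; congr (_ + _).
  rewrite -(sw2_coassoc (F := fun y1 y2 y3 =>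
    \cop[c1, c2 <- c] (fox_half x b y1 c2 * rgen y2 c1 * rgen y3 e))); last by trilin_tac.
  apply: eq_sw2 => Y y3; rewrite sw2_mull; apply: eq_sw2 => y1 y2.
  by rewrite sw2_mull.
rewrite -(sw2_coassoc (F := fun y1 y2 y3 =>
    \cop[e1, e2 <- e] (fox_half x b y1 e2 * rgen y2 c * rgen y3 e1))); last by trilin_tac.
transitivity (\cop[Y, y3 <- y] \cop[e1, e2 <- e] \cop[y1, y2 <- Y]
   (gsign (p + n) (rgen y1 c : R) * fox_half x b y2 e2 * rgen y3 e1)).
  apply: eq_sw2 => Y y3; rewrite sw2_exchange; apply: eq_sw2 => e1 e2.
  by rewrite -sw2_mull fox_half_comm sw2_mull.
under eq_sw2 => Y y3 do rewrite sw2_exchange.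
rewrite (sw2_coassoc (F := fun y1 y2 y3 => \cop[e1, e2 <- e]
   (gsign (p + n) (rgen y1 c : R) * fox_half x b y2 e2 * rgen y3 e1))); last by trilin_tac.
apply: eq_sw2 => y1 Y; rewrite sw2_mulr; apply: eq_sw2 => y2 y3.
by rewrite sw2_mulr; apply: eq_sw2 => e1 e2; rewrite mulrA.
Qed.

(** What [fox_half] becomes when the term rho(x'', y) z of the Fox rule for
    rho(x'', yz) is kept. *)
Definition fox_half_mul y z e : R :=
  \cop[x1, x2 <- x] \cop[b1, b2 <- b] (rgen x1 b2 * coad (rho x2 y * z) b1 e).

Lemma fox_half_mul_gr q r y z e : gr q y -> gr r z ->
  gr (q + r + (p + n)) (fox_half_mul y z e).
Proof.
have [m1 m2 m3] := m_lin; have [rgr _ _] := rho_fox.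
move=> yq zr; apply: (gr_sw2 _ xp); first by bilin_tac.
move=> k s u v uk vs ks; apply: gr_sum => i _.
apply: gr_eq (gr_M _ _ _ _ (rgen_gr B0 _ uk)
  (coad_gr bul B0 _ _ (gr_M _ _ _ _ (rgr _ _ _ _ vs yq) zr))) _.
by rewrite -ks; ring.
Qed.

Lemma fox_halfMl y z e :
  fox_half x b (y * z) e = fox_half_mul y z e + counit y *: fox_half x b z e.
Proof.
have [m1 m2 m3] := m_lin; have [_ rM _] := rho_fox.
rewrite -sw2Z -sw2Dl; apply: eq_sw2 => x1 x2; rewrite -sw2Z -sw2Dl.
apply: eq_sw2 => b1 b2; rewrite rM addrC m1 mulrDr -scalerAr addrC.
by [].
Qed.

Lemma fox_half_mul_absorb y z c :
  \cop[z1, z2 <- z] \cop[c1, c2 <- c] (fox_half_mul y z1 c2 * rgen z2 c1) =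
  \cop[c1, c2 <- c] (fox_half x b y c1 * rgen z c2).
Proof.
transitivity (\cop[x1, x2 <- x] \cop[b1, b2 <- b] (rgen x1 b2 *
   \cop[z1, z2 <- z] \cop[c1, c2 <- c] (coad (rho x2 y * z1) b1 c2 * rgen z2 c1))).
  under eq_sw2 => z1 z2 do under eq_sw2 => c1 c2 do rewrite sw2_mull.
  under eq_sw2 => z1 z2 do rewrite sw2_exchange.
  rewrite sw2_exchange; apply: eq_sw2 => x1 x2.
  under eq_sw2 => z1 z2 do under eq_sw2 => c1 c2 do rewrite sw2_mull.
  under eq_sw2 => z1 z2 do rewrite sw2_exchange.
  rewrite sw2_exchange; apply: eq_sw2 => b1 b2.
  rewrite sw2_mulr; apply: eq_sw2 => z1 z2.
  by rewrite sw2_mulr; apply: eq_sw2 => c1 c2; rewrite mulrA.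
under eq_sw2 => x1 x2 do under eq_sw2 => b1 b2 do
  rewrite (coad_absorbr B0 Bc bul_bal) sw2_mulr.
under eq_sw2 => x1 x2 do rewrite sw2_exchange.
rewrite sw2_exchange; apply: eq_sw2 => c1 c2.
rewrite sw2_mull; apply: eq_sw2 => x1 x2; rewrite sw2_mull; apply: eq_sw2 => b1 b2.
by rewrite mulrA.
Qed.

Lemma fox_half_mul_linear y e : is_linear (fun z => fox_half_mul y z e).
Proof. by have [m1 m2 m3] := m_lin; rewrite /fox_half_mul; lin. Qed.

Lemma fox_half_mul_linear3 y z : is_linear (fox_half_mul y z).
Proof. by have [m1 m2 m3] := m_lin; rewrite /fox_half_mul; lin. Qed.

(** The Fox rule splits the left side into two sums.  In the first, z' is absorbed
    into z''_(c'') and what remains is the first term; in the second, y' is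
    contracted with the counit and y''_(c') moves to the left. *)
Lemma fox_gen_mull y z c : fox_gen x b (y * z) c =
  \cop[c1, c2 <- c]
    (fox_gen x b y c1 * rgen z c2 + gsign (p + n) (rgen y c1) * fox_gen x b z c2).
Proof.
have [f1 f2] := fox_half_bilinear; have gl := @gsign_linear _ R (p + n).
have h1 := fox_half_mul_linear; have h2 := fox_half_mul_linear3.
have [s Es] := hexp_exists (comul y); have [t Et] := hexp_exists (comul z).
(* The two sums, once y''_(c') has been moved to the left. *)
pose T1 c1 c2 c3 (h k : homog A * homog A) : R :=
  ksign ('|h.2| * (p + n + '|h.1|)) *: (rgen (hval h.2) c1 *
    (fox_half_mul (hval h.1) (hval k.1) c3 * rgen (hval k.2) c2)).
pose T2 c1 c2 c3 (h k : homog A * homog A) : R := counit (hval h.1) *: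
  (gsign (p + n) (rgen (hval h.2) c1) *
    (fox_half x b (hval k.1) c3 * rgen (hval k.2) c2)).
transitivity (\sum_(h <- s) \sum_(k <- t) \cop[c1, d <- c] \cop[c2, c3 <- d]
    (T1 c1 c2 c3 h k + T2 c1 c2 c3 h k)).
  rewrite /fox_gen (sw2_mul _ Es Et); last by bilin_tac.
  apply: eq_bigr => h _; apply: eq_bigr => k _.
  rewrite -(sw2_coassoc (F := fun c1 c2 c3 => T1 c1 c2 c3 h k + T2 c1 c2 c3 h k));
    last by rewrite /T1 /T2; trilin_tac.
  rewrite -sw2Z; apply: eq_sw2 => C c3.
  rewrite rgenM_sw2 sw2_mulr -sw2Z; apply: eq_sw2 => c1 c2.
  have r2 := rgen_gr B0 c1 (hvalP h.2).
  rewrite fox_halfMl mulrDl scalerDr /T1 /T2 !mulrA; congr (_ + _).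
    rewrite (repalg_commE (fox_half_mul_gr c3 (hvalP h.1) (hvalP k.1)) r2).
    by rewrite -scalerAl; ksign_tac.
  rewrite -!scalerAl (repalg_commE (fox_half_gr c3 (hvalP k.1)) r2).
  rewrite (gsign_homog _ r2) -!scalerAl !scalerA; congr (_ *: _).
  by rewrite mulrCA; congr (_ * _); ksign_tac.
under eq_bigr => h _ do under eq_bigr => k _ do
  under eq_sw2 => c1 d do rewrite sw2Dl.
under eq_bigr => h _ do under eq_bigr => k _ do rewrite sw2Dl.
under eq_bigr => h _ do rewrite big_split.
rewrite big_split sw2Dl /=; congr (_ + _).
  under [RHS]eq_sw2 => c1 c2 do rewrite /fox_gen sw2_mull.
  rewrite sw2_exchange (sw2_hexp _ Es); last by bilin_tac.
  apply: eq_bigr => h _; rewrite sw2_sum.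
  transitivity (\cop[c1, d <- c] \cop[d1, d2 <- d]
      (fox_half x b (hval h.1) d1 * rgen (hval h.2) c1 * rgen z d2)); last first.
    rewrite -(sw2_coassoc (F := fun c1 d1 d2 =>
      fox_half x b (hval h.1) d1 * rgen (hval h.2) c1 * rgen z d2)); last by trilin_tac.
    by apply: eq_sw2 => C d2; rewrite sw2_mull.
  apply: eq_sw2 => c1 d.
  transitivity (ksign ('|h.2| * (p + n + '|h.1|)) *: (rgen (hval h.2) c1 *
      \cop[z1, z2 <- z] \cop[c2, c3 <- d]
        (fox_half_mul (hval h.1) z1 c3 * rgen z2 c2))).
    rewrite sw2_mulr -sw2Z (sw2_hexp _ Et); last by bilin_tac.
    apply: eq_bigr => k _; rewrite sw2_mulr -sw2Z.
    by [].
  rewrite fox_half_mul_absorb sw2_mulr -sw2Z; apply: eq_sw2 => d1 d2.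
  rewrite (repalg_commE (fox_half_gr d1 (hvalP h.1)) (rgen_gr B0 c1 (hvalP h.2))).
  by rewrite -scalerAl mulrA; ksign_tac.
rewrite exchange_big /= /fox_gen.
transitivity (\sum_(k <- t) \cop[c1, d <- c] \cop[c2, c3 <- d]
  (gsign (p + n) (rgen y c1) * (fox_half x b (hval k.1) c3 * rgen (hval k.2) c2))).
  apply: eq_bigr => k _; rewrite sw2_sum; apply: eq_sw2 => c1 d.
  rewrite sw2_sum; apply: eq_sw2 => c2 c3.
  rewrite -(sw2_counitl (f := fun y => gsign (p + n) (rgen y c1 : R) *
    (fox_half x b (hval k.1) c3 * rgen (hval k.2) c2))); last by lin.
  by rewrite (sw2_hexp _ Es) //; bilin_tac.
rewrite sw2_sum; apply: eq_sw2 => c1 d.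
rewrite (sw2_hexp _ Et); last by bilin_tac.
rewrite mulr_sumr; apply: eq_bigr => k _.
by rewrite sw2_mulr.
Qed.

Lemma fox_gen_gr q y c : gr q y -> gr (q + (p + n)) (fox_gen x b y c).
Proof.
have [f1 f2] := fox_half_bilinear.
move=> yq; apply: (gr_sw2 _ yq); first by bilin_tac.
move=> k s u v uk vs ks; apply: gr_sum => i _.
apply: gr_eq (gr_M _ _ _ _ (fox_half_gr _ uk) (rgen_gr B0 _ vs)) _.
by rewrite -ks; ring.
Qed.

Lemma fox_gen_bilinear : is_bilinear (fox_gen x b).
Proof. by have [f1 f2] := fox_half_bilinear; rewrite /fox_gen; bilin_tac. Qed.

Lemma fox_gen_data : derivation_data (p + n) (fox_gen x b).
Proof.
split; first exact: fox_gen_bilinear.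
- by move=> q y c; apply: fox_gen_gr.
- exact: fox_gen_mull.
- exact: fox_gen_mulr.
Qed.

End FixedLeftGenerator.

(** rho(w, s(y')) expands as - rho(w, y') s(y''), whose last factor is absorbed. *)
Lemma fox_antipode_absorbr w b y c :
  \cop[y1, y2 <- y] \cop[c1, c2 <- c] (coad (rho w (antipode y1)) b c1 * rgen y2 c2) =
  - \cop[y1, y2 <- y] \cop[c1, c2 <- c] (coad (rho w y1) b c2 * rgen y2 c1).
Proof.
have [m1 m2 m3] := @coad_trilinear K A B bul.
transitivity (- \cop[Y, y3 <- y] \cop[y1, y2 <- Y] \cop[c1, c2 <- c]
    (coad (rho w y1 * antipode y2) b c1 * rgen y3 c2)).
  rewrite -sw2N; apply: eq_sw2 => Y y3; rewrite [in RHS]sw2_exchange -sw2N.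
  apply: eq_sw2 => c1 c2; rewrite (fox_pairing_antipoder rho_fox).
  rewrite (linear_funN _ (m1 _ _)) mulNr (sw2_linear _ _ (m1 _ _)) sw2_mull.
  by [].
rewrite (sw2_coassoc (F := fun y1 y2 y3 => \cop[c1, c2 <- c]
    (coad (rho w y1 * antipode y2) b c1 * rgen y3 c2))); last by trilin_tac.
by congr (- _); apply: eq_sw2 => y1 Y; rewrite (coad_absorbr_antipode B0 Bc bul_bal).
Qed.

Lemma fox_antipode_absorbl x b y e :
  \cop[x1, x2 <- x] \cop[b1, b2 <- b] (rgen x1 b1 * coad (rho (antipode x2) y) b2 e) =
  - fox_half x b y e.
Proof.
have [m1 m2 m3] := @coad_trilinear K A B bul.
transitivity (- \cop[x1, X <- x] \cop[x2, x3 <- X] \cop[b1, b2 <- b]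
    (rgen x1 b1 * coad (antipode x2 * rho x3 y) b2 e)).
  rewrite -sw2N; apply: eq_sw2 => x1 X; rewrite [in RHS]sw2_exchange -sw2N.
  apply: eq_sw2 => b1 b2; rewrite (fox_pairing_antipodel rho_fox).
  rewrite (linear_funN _ (m1 _ _)) mulrN (sw2_linear _ _ (m1 _ _)) sw2_mulr.
  by [].
rewrite -(sw2_coassoc (F := fun x1 x2 x3 => \cop[b1, b2 <- b]
    (rgen x1 b1 * coad (antipode x2 * rho x3 y) b2 e))); last by trilin_tac.
by congr (- _); apply: eq_sw2 => X x3; rewrite (coad_absorbl_antipode bul B0 Bc).
Qed.

(** Up to a Koszul sign, rho(y'', x') is - s^-1 rho(s(x'), s(y'')), and the
    inverse antipode exchanges the roles of b and c in coad.  Reversing the order of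
    the three factors and of both coproducts collects the stated sign.  The two
    remaining antipodes are absorbed, each with a sign -1. *)
Lemma fox_gen_antisym p q x b y c : gr p x -> gr q y ->
  fox_gen y c x b = - (ksign ((p + n) * (q + n)) *: fox_gen x b y c).
Proof.
have [m1 m2 m3] := @coad_trilinear K A B bul.
have [rgr _ _] := rho_fox.
move=> xp yq.
have [s Es s_deg] := comul_gr _ _ xp; have [t Et t_deg] := comul_gr _ _ yq.
pose T x1 x2 y1 y2 : R := \cop[b1, b2 <- b] \cop[c1, c2 <- c]
  (rgen x1 b1 * coad (rho (antipode x2) (antipode y1)) b2 c1 * rgen y2 c2).
transitivity (- (ksign ((p + n) * (q + n)) *:
    \cop[x1, x2 <- x] \cop[y1, y2 <- y] T x1 x2 y1 y2)).
  rewrite fox_genE (sw2_cocomm Ac _ Et); last by bilin_tac.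
  rewrite sw2_exchange (sw2_hexp _ Et); last by rewrite /T; bilin_tac.
  rewrite scaler_sumr -sumrN; apply: eq_big_all t_deg _ => k /eqP k_deg.
  rewrite [X in _ *: X = _](sw2_cocomm Ac _ Es); last by bilin_tac.
  rewrite (sw2_hexp _ Es); last by rewrite /T; bilin_tac.
  rewrite !scaler_sumr -sumrN; apply: eq_big_all s_deg _ => h /eqP h_deg.
  rewrite sw2_exchange /T -!sw2Z -sw2N; apply: eq_sw2 => b1 b2.
  rewrite -!sw2Z -sw2N; apply: eq_sw2 => c1 c2.
  have r1 := rgen_gr B0 b1 (hvalP h.1); have r2 := rgen_gr B0 c2 (hvalP k.2).
  have mr := coad_gr bul B0 c1 b2 (rgr _ _ _ _ (hvalP k.1) (hvalP h.2)).
  rewrite -mulrA (repalg_commE r2 (gr_M _ _ _ _ mr r1)).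
  rewrite (repalg_commE mr r1) -(coad_antipode B0 Bc bul_bal (rho (hval k.1) _)).
  rewrite (fox_antisymmetric_antipode Ac rho_anti (hvalP h.2) (hvalP k.1)).
  rewrite (linear_funN _ (m1 _ _)) (linear_funZ _ _ (m1 _ _)).
  rewrite mulrN scalerN mulNr -scalerAr -!scalerAl !scalerN; congr (- _).
  by rewrite -h_deg -k_deg; ksign_tac.
congr (- (_ *: _)).
transitivity (\cop[x1, x2 <- x] \cop[b1, b2 <- b] (rgen x1 b1 *
    \cop[y1, y2 <- y] \cop[c1, c2 <- c]
      (coad (rho (antipode x2) (antipode y1)) b2 c1 * rgen y2 c2))).
  apply: eq_sw2 => x1 x2; rewrite sw2_exchange; apply: eq_sw2 => b1 b2.
  rewrite sw2_mulr; apply: eq_sw2 => y1 y2; rewrite sw2_mulr.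
  by apply: eq_sw2 => c1 c2; rewrite mulrA.
under eq_sw2 => x1 x2 do under eq_sw2 => b1 b2 do
  rewrite fox_antipode_absorbr mulrN sw2_mulr.
rewrite /fox_gen.
transitivity (- \cop[y1, y2 <- y] \cop[c1, c2 <- c] ((\cop[x1, x2 <- x]
    \cop[b1, b2 <- b] (rgen x1 b1 * coad (rho (antipode x2) y1) b2 c2)) *
    rgen y2 c1)).
  under eq_sw2 => x1 x2 do rewrite sw2N sw2_exchange.
  rewrite sw2N sw2_exchange; congr (- _); apply: eq_sw2 => y1 y2.
  under eq_sw2 => x1 x2 do under eq_sw2 => b1 b2 do rewrite sw2_mulr.
  under eq_sw2 => x1 x2 do rewrite sw2_exchange.
  rewrite sw2_exchange; apply: eq_sw2 => c1 c2.
  rewrite sw2_mull; apply: eq_sw2 => x1 x2; rewrite sw2_mull.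
  by apply: eq_sw2 => b1 b2; rewrite mulrA.
rewrite -sw2N; apply: eq_sw2 => y1 y2; rewrite -sw2N; apply: eq_sw2 => c1 c2.
by rewrite fox_antipode_absorbl mulNr opprK.
Qed.

(** The coproduct of x is reversed, and x''_b is moved past the factor coad. *)
Lemma fox_gen_formula x y b c X Y : hexp (comul x) X -> hexp (comul y) Y ->
  fox_gen x b y c = \sum_(p <- X) \sum_(q <- Y)
    let: (x1, x2) := p in let: (y1, y2) := q in
    sweedler4 (fun b1 b2 b3 b4 => sweedler2 (fun c1 c2 =>
      (ksign ('|x2| * ('|y1| + n)) * bul c2 b2) *:
        (rgen (rho (hval x1) (hval y1)) (antipode b3 * b1)
         * rgen (hval x2) b4 * rgen (hval y2) c1)) c) b.
Proof.
have [m1 m2 m3] := @coad_trilinear K A B bul; have [rgr _ _] := rho_fox.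
move=> EX EY; rewrite fox_genE (sw2_cocomm Ac _ EX); last by bilin_tac.
apply: eq_bigr => -[x1 x2] _ /=.
rewrite (sw2_hexp _ EY) ?scaler_sumr; last by bilin_tac.
apply: eq_bigr => -[y1 y2] _ /=.
set r := rho (hval x1) (hval y1); have r_gr := rgr _ _ _ _ (hvalP x1) (hvalP y1).
pose F b1 b2 b3 b4 : R := \cop[c1, c2 <- c]
  (ksign ('|x2| * ('|y1| + n)) *: (bul c2 b2 *:
    (rgen r (antipode b3 * b1) * rgen (hval x2) b4 * rgen (hval y2) c1))).
transitivity (\cop[d, b4 <- b] \cop[b1, w <- d] \cop[b2, b3 <- w] F b1 b2 b3 b4);
  last first.
  rewrite (sw2_coassoc (F := fun b1 w b4 => \cop[b2, b3 <- w] F b1 b2 b3 b4)).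
    apply: eq_sw2 => b1 w.
    rewrite (sw2_coassoc (F := F b1)); last by rewrite /F; trilin_tac.
    apply: eq_sw2 => b2 w'; apply: eq_sw2 => b3 b4.
    by apply: eq_sw2 => c1 c2; rewrite scalerA.
  by rewrite /F; trilin_tac.
rewrite -sw2Z; apply: eq_sw2 => d b4.
transitivity (\cop[c1, c2 <- c] (ksign ('|x2| * ('|y1| + n)) *:
    (coad r d c2 * rgen (hval x2) b4 * rgen (hval y2) c1))).
  rewrite -sw2Z; apply: eq_sw2 => c1 c2.
  rewrite (repalg_commE (rgen_gr B0 b4 (hvalP x2)) (coad_gr bul B0 d c2 r_gr)).
  by rewrite -scalerAl; ksign_tac.
rewrite /F; under [RHS]eq_sw2 => b1 w do rewrite sw2_exchange.
rewrite [RHS]sw2_exchange; apply: eq_sw2 => c1 c2.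
rewrite !sw2_mull -sw2Z; apply: eq_sw2 => b1 w.
rewrite !sw2_mull -sw2Z; apply: eq_sw2 => b2 b3.
by rewrite -!scalerAl.
Qed.

End FoxBracketOnGenerators.

(** * Extension from generators to the whole algebra *)

Section GradedBrackets.
Variables (K : comNzRingType) (A B : gradedBialgType K) (n : int).
Hypothesis B0 : ungraded B.
Notation R := (repalg A B).
Implicit Types (x y : A) (b c : B) (u v w : R) (p q r : int).

Lemma graded_bracket_derivation (br : {bilinear R -> R -> R}) p u :
  graded_bracket n br -> gr p u -> graded_derivation (p + n) (br u).
Proof.
case=> _ brr _ up; split=> [a v w|q v w vq]; first exact: linearPr.
move: w; apply: homog_eq => [||r w wr]; [by lin|by lin|].
exact: (brr (Homog up) (Homog vq) (Homog wr)).
Qed.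

(** Agreement passes from generators to all second arguments by the Leibniz rule on
    the right, then to all first arguments by the one on the left. *)
Lemma graded_bracket_unique (br br' : {bilinear R -> R -> R}) :
  graded_bracket n br -> graded_bracket n br' ->
  (forall x b y c, br (rgen x b) (rgen y c) = br' (rgen x b) (rgen y c)) ->
  br =2 br'.
Proof.
move=> brP brP' E u v; move: u; apply: homog_eq; [by lin|by lin|].
have [_ _ brl] := brP; have [_ _ brl'] := brP'.
move=> p u up; move: p u up v; apply: (repalg_homog_ind B0).
- by move=> p v; rewrite !linear0l.
- by move=> p a u v _ _ Eu Ev w; rewrite !linearPl Eu Ev.
- have br1 (f : {bilinear R -> R -> R}) v : graded_bracket n f -> f 1 v = 0.
    case=> _ _ fl; move: v; apply: homog_eq; [by lin|by lin|move=> r w wr].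
    have := fl (Homog gr_1) (Homog gr_1) (Homog wr).
    rewrite /= mul0r ksign0 scale1r !mulr1 mul1r -[X in X = _]addr0.
    by move/addrI.
  by move=> v; rewrite !br1 //.
- move=> p q u v up vq Eu Ev w; move: w; apply: homog_eq; [by lin|by lin|].
  move=> r w wr; have /= -> := brl (Homog up) (Homog vq) (Homog wr).
  by have /= -> := brl' (Homog up) (Homog vq) (Homog wr); rewrite Eu Ev.
- move=> p x b xp.
  have xb : gr p (rgen x b : R) := rgen_gr B0 b xp.
  apply: (graded_derivation_ext B0 (graded_bracket_derivation brP xb)
    (graded_bracket_derivation brP' xb)).
  by move=> y c; apply: E.
Qed.

Section BracketOfGenerators.
Variable Q : A -> B -> A -> B -> R.
Hypothesis Q_linear : forall b y c, is_linear (fun x => Q x b y c).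
Hypothesis Q_data : forall p x b, gr p x -> derivation_data (p + n) (Q x b).
Hypothesis Q_antisym : forall p q x b y c, gr p x -> gr q y ->
  Q y c x b = - (ksign ((p + n) * (q + n)) *: Q x b y c).

(** The bracket of an element of degree [p] with the generator y_c, determined by
    antisymmetry from the derivation extending [Q y c]. *)
Definition bracket_rgen p u y c : R :=
  - homog_sum (fun q y => ksign ((p + n) * (q + n)) *: der_of (q + n) (Q y c) u) y.

Let der_linear q c u : is_linear (fun y => der_of (q + n) (Q y c) u).
Proof.
move=> a y z; rewrite -der_of_linear_data; congr (der_of _ _ u).
by apply/funext => x; apply/funext => b; apply: Q_linear.
Qed.

Let der_linear_sign p q c u :
  is_linear (fun y => ksign ((p + n) * (q + n)) *: der_of (q + n) (Q y c) u).
Proof. exact/lin_scale/der_linear. Qed.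

Lemma bracket_rgen_linear p u c : is_linear (fun y => bracket_rgen p u y c).
Proof. by apply: lin_opp; apply: homog_sum_linear => q; apply: der_linear_sign. Qed.

Lemma bracket_rgen_homog p u q y c : gr q y -> bracket_rgen p u y c =
  - (ksign ((p + n) * (q + n)) *: der_of (q + n) (Q y c) u).
Proof.
by move=> yq; congr (- _); apply: (homog_sum_homog (fun q => der_linear_sign p q c u) yq).
Qed.

Lemma bracket_rgen_linearl p a u v :
  bracket_rgen p (a *: u + v) =
  fun y c => a *: bracket_rgen p u y c + bracket_rgen p v y c.
Proof.
apply/funext => y; apply/funext => c; rewrite /bracket_rgen scalerN -opprD.
congr (- _); rewrite /homog_sum scaler_sumr -big_split; apply: eq_bigr => h _ /=.
have [dl _] := der_of_derivation B0 (Q_data c (hvalP h)).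
by rewrite dl scalerDr !scalerA mulrC.
Qed.

Lemma bracket_rgen_rgen p x b : gr p x -> bracket_rgen p (rgen x b) = Q x b.
Proof.
move=> xp; apply/funext => y; apply/funext => c; move: y; apply: homog_eq.
- exact: bracket_rgen_linear.
- by have [[Q1 Q2] _ _ _] := Q_data b xp.
move=> q y yq; rewrite (bracket_rgen_homog _ _ _ yq).
rewrite (der_of_rgen B0 (Q_data c yq)) (Q_antisym _ _ xp yq).
by rewrite scalerN opprK scalerA ksign_sqr scale1r.
Qed.

(** Besides the Leibniz rule, one commutation is used so that the sign becomes
    independent of [y] and [c]; this is what lets [bracket_rgen_data] pass to
    products. *)
Lemma bracket_rgenM p q u v : gr p u -> gr q v ->
  bracket_rgen (p + q) (u * v) =
  fun y c => ksign (p * q) *: (v * bracket_rgen p u y c) + u * bracket_rgen q v y c.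
Proof.
move=> up vq; apply/funext => y; apply/funext => c; move: y; apply: homog_eq.
- exact: bracket_rgen_linear.
- by have h1 := @bracket_rgen_linear; apply: lin_add; [apply/lin_scale/lin_mulr|
    apply/lin_mulr]; apply: h1.
move=> r y yr; rewrite !(bracket_rgen_homog _ _ _ yr).
have dd := der_of_derivation B0 (Q_data c yr); have [dl dM] := dd.
rewrite (dM _ _ _ up) !mulrN scalerN -opprD; congr (- _).
rewrite scalerDr -!scalerAr !scalerA; congr (_ + _); last by ksign_tac.
rewrite (repalg_commE (der_of_gr B0 (Q_data c yr) up) vq); ksign_tac.
Qed.

(** Derivation data are stable under sums and left multiplication, so by
    [bracket_rgenM] the claim passes from generators to products. *)
Lemma bracket_rgen_data p u : gr p u -> derivation_data (p + n) (bracket_rgen p u).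
Proof.
move: p u; apply: (repalg_homog_ind B0).
- move=> p; have -> : bracket_rgen p 0 = fun _ _ => 0; last exact: derivation_data0.
  have := bracket_rgen_linearl p (-1) 0 0; rewrite scaler0 addr0 => ->.
  by apply/funext => y; apply/funext => c; rewrite scaleN1r addNr.
- by move=> p a u v _ _ du dv; rewrite bracket_rgen_linearl; apply: derivation_dataP.
- have -> : bracket_rgen 0 1 = fun _ _ => 0; last exact: derivation_data0.
  apply/funext => y; apply/funext => c; move: y; apply: homog_eq.
  + exact: bracket_rgen_linear.
  + exact: lin_0.
  move=> r y yr; rewrite (bracket_rgen_homog _ _ _ yr).
  rewrite (graded_derivation1 (der_of_derivation B0 (Q_data c yr))).
  by rewrite scaler0 oppr0.
- move=> p q u v up vq du dv; rewrite (bracket_rgenM up vq).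
  apply: derivation_dataP.
    have -> : p + q + n = q + (p + n) by ring.
    exact: derivation_data_mull.
  have -> : p + q + n = p + (q + n) by ring.
  exact: derivation_data_mull.
- by move=> p x b xp; rewrite bracket_rgen_rgen //; apply: Q_data.
Qed.

(** {u, -} is the derivation with values {u, y_c} on the generators. *)
Definition bracket_ext u v : R :=
  homog_sum (fun p u => der_of (p + n) (bracket_rgen p u) v) u.

Let bracket_ext_family p v : is_linear (fun u => der_of (p + n) (bracket_rgen p u) v).
Proof. by move=> a u w; rewrite bracket_rgen_linearl der_of_linear_data. Qed.

Lemma bracket_ext_homog p u v : gr p u ->
  bracket_ext u v = der_of (p + n) (bracket_rgen p u) v.
Proof. exact: (homog_sum_homog (fun p => bracket_ext_family p v)). Qed.

Lemma bracket_ext_bilinear : is_bilinear bracket_ext.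
Proof.
split=> [v|u]; first by apply: homog_sum_linear => p; apply: bracket_ext_family.
move=> a v w; rewrite /bracket_ext /homog_sum scaler_sumr -big_split.
apply: eq_bigr => h _.
by have [dl _] := der_of_derivation B0 (bracket_rgen_data (hvalP h)); apply: dl.
Qed.

Lemma bracket_ext_derivation p u : gr p u ->
  graded_derivation (p + n) (bracket_ext u).
Proof.
move=> up; have [dl dM] := der_of_derivation B0 (bracket_rgen_data up).
split=> [|q v w vq]; first by case: bracket_ext_bilinear.
by rewrite !(bracket_ext_homog _ up) (dM _ _ _ vq).
Qed.

Lemma bracket_ext_rgen x b y c : bracket_ext (rgen x b) (rgen y c) = Q x b y c.
Proof.
have [b1 b2] := bracket_ext_bilinear.
move: x; apply: homog_eq; [by lin|exact: Q_linear|move=> p x xp].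
have xb : gr p (rgen x b : R) := rgen_gr B0 b xp.
rewrite (bracket_ext_homog _ xb) (der_of_rgen B0 (bracket_rgen_data xb)).
by rewrite bracket_rgen_rgen.
Qed.

(** Both sides are derivations in [w], so it suffices to take a generator for [w]. *)
Lemma bracket_extM p q r u v w : gr p u -> gr q v -> gr r w ->
  bracket_ext (u * v) w = u * bracket_ext v w +
    ksign (q * (r + n)) *: (bracket_ext u w * v).
Proof.
move=> up vq wr; have uv := gr_M _ _ _ _ up vq.
have du := bracket_rgen_data up; have dv := bracket_rgen_data vq.
transitivity (ksign (p * q) *: (v * bracket_ext u w) + u * bracket_ext v w).
  move: w {wr}; apply: (graded_derivation_ext B0 (d := p + q + n)).
  - exact: bracket_ext_derivation.
  - apply: graded_derivationD; first apply: graded_derivationZ.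
      have -> : p + q + n = q + (p + n) by ring.
      apply: graded_derivation_mull vq _ => //; first exact: repalg_comm.
      exact: bracket_ext_derivation.
    have -> : p + q + n = p + (q + n) by ring.
    apply: graded_derivation_mull up _ => //; first exact: repalg_comm.
    exact: bracket_ext_derivation.
  move=> y c; rewrite (bracket_ext_homog _ uv) (bracket_ext_homog _ up).
  rewrite (bracket_ext_homog _ vq) !(der_of_rgen B0) ?bracket_rgenM //.
  by rewrite -bracket_rgenM //; apply: bracket_rgen_data.
rewrite addrC (bracket_ext_homog w up); congr (_ + _).
rewrite (repalg_commE vq (der_of_gr B0 du wr)); ksign_tac.
Qed.

(** Both sides are derivations in [v]: the right side is one by [bracket_extM]. *)
Lemma bracket_ext_antisym p q u v : gr p u -> gr q v ->
  bracket_ext u v = - (ksign ((p + n) * (q + n)) *: bracket_ext v u).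
Proof.
move=> up vq; have [e1 e2] := bracket_ext_bilinear.
have gl := @gsign_linear _ R (p + n).
(* The right side for inhomogeneous [w]. *)
pose G w := - (ksign ((p + n) * n) *: bracket_ext (gsign (p + n) w) u).
have Gl : is_linear G by rewrite /G; lin.
have GE r w : gr r w -> G w = - (ksign ((p + n) * (r + n)) *: bracket_ext w u).
  move=> wr; rewrite /G (gsign_homog _ wr) (linear_funZ _ _ (e1 _)) mulrDr addrC.
  by ksign_tac.
rewrite -(GE _ _ vq); move: v {q vq}.
apply: (graded_derivation_ext B0 (d := p + n)).
- exact: bracket_ext_derivation.
- split=> // q v w vq; move: w; apply: homog_eq; [by lin|by lin|move=> r w wr].
  rewrite (GE _ _ (gr_M _ _ _ _ vq wr)) (GE _ _ vq) (GE _ _ wr).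
  rewrite (bracket_extM vq wr up) scalerDr opprD addrC mulNr mulrN scalerN.
  by rewrite -scalerAl -scalerAr; congr (_ + _); ksign_tac.
move=> y c; move: y; apply: homog_eq; [by lin|by lin|move=> q y yq].
have yc : gr q (rgen y c : R) := rgen_gr B0 c yq.
rewrite (GE _ _ yc) (bracket_ext_homog _ up) (bracket_ext_homog _ yc).
rewrite (der_of_rgen B0 (bracket_rgen_data up)) (bracket_rgen_homog _ _ _ yq).
by rewrite bracket_rgen_rgen.
Qed.

Lemma bracket_of_generators : exists br : {bilinear R -> R -> R},
  [/\ graded_bracket n br, forall x b y c, br (rgen x b) (rgen y c) = Q x b y c
    & bracket_antisymmetric n br].
Proof.
have ext_bil := is_bilinearW bracket_ext_bilinear.
pose br : {bilinear R -> R -> R} := HB.pack bracket_ext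
  (bilinear_isBilinear.Build K R R R *:%R *:%R bracket_ext ext_bil).
exists br; split; last first.
- by move=> [u p up] [v q vq]; apply: bracket_ext_antisym.
- exact: bracket_ext_rgen.
split=> [p q u v up vq|[u p up] [v q vq] [w r wr]|[u p up] [v q vq] [w r wr]] /=.
- rewrite /= (bracket_ext_homog _ up).
  by apply: gr_eq (der_of_gr B0 (bracket_rgen_data up) vq) _; ring.
- by have [_ dM] := bracket_ext_derivation up; apply: dM.
- exact: (bracket_extM up vq wr).
Qed.

End BracketOfGenerators.
End GradedBrackets.

Theorem theorem6p1 (K : comNzRingType) (A B : gradedHopfType K) (n : int)
    (rho : {bilinear A -> A -> A}) (bul : {bilinear B -> B -> K | *%R & *%R}) :
  cocommutative A ->
  fox_pairing n rho ->
  fox_antisymmetric n rho ->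
  ungraded B ->
  graded_commutative B ->
  biderivation bul ->
  balanced bul ->
  exists br : {bilinear repalg A B -> repalg A B -> repalg A B},
    [/\ graded_bracket n br,
        fox_bracket_formula n rho bul br,
        forall br' : {bilinear repalg A B -> repalg A B -> repalg A B},
          graded_bracket n br' -> fox_bracket_formula n rho bul br' ->
          br' =2 br
      & bracket_antisymmetric n br].
Proof.
move=> Ac rho_fox rho_anti B0 Bc bul_bider bul_bal.
have [|p x b xp|p q x b y c xp yq|br [brP brE br_anti]] :=
  @bracket_of_generators K A B n B0 (fox_gen rho bul).
- by move=> b y c; apply: fox_gen_linear1.
- exact: (fox_gen_data Ac rho_fox B0 Bc bul_bider bul_bal b xp).
- exact: (fox_gen_antisym Ac rho_fox rho_anti B0 Bc bul_bal).
have brF : fox_bracket_formula n rho bul br.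
  move=> x y b c X Y EX EY; rewrite brE.
  exact: (fox_gen_formula bul Ac rho_fox B0).
exists br; split=> // br' brP' brF'.
apply: (graded_bracket_unique B0 brP' brP) => x b y c.
have [X EX] := hexp_exists (comul x); have [Y EY] := hexp_exists (comul y).
by rewrite (brF' _ _ _ _ _ _ EX EY) (brF _ _ _ _ _ _ EX EY).
Qed.
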